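(* For each $d\in\mathbb{N}$ let $X_i^{(d)}=(X_{i,1}^{(d)},\ldots,X_{i,d}^{(d)})$, $i\ge 1$, be i.i.d. random vectors in $\mathbb{R}^d$. Suppose that the following conditions hold. (a) For every $d$: $\mathbf{E}X_1^{(d)}=0$ and $\mathbf{E}\|X_1^{(d)}\|^2=1$. (b) For every $d$, the components of $X_1^{(d)}$ are mutually uncorrelated: $\mathbf{E}\big[X_{1,j}^{(d)}X_{1,k}^{(d)}\big]=0$ for all $j,k\in\{1,\ldots,d\}$ with $j\neq k$. (c) The sequence $(\|X_1^{(d)}\|^2)_{d\in\mathbb{N}}$ is uniformly integrable: $\lim_{A\to\infty}\sup_{d\in\mathbb{N}}\mathbf{E}\big(\|X_1^{(d)}\|^2\mathbf{1}_{\{\|X_1^{(d)}\|^2>A\}}\big)=0$. (d) $\lim_{d\to\infty}\max_{k\in\{1,\ldots,d\}}\mathbf{E}\big(X_{1,k}^{(d)}\big)^2=0$. Let $n=n(d)$ be an arbitrary sequence of positive integers such that $n(d)\to\infty$ as $d\to\infty$. Put $S_0^{(d)}=0$, $S_k^{(d)}=X_1^{(d)}+\cdots+X_k^{(d)}$, $B_k^{(d)}=S_k^{(d)}-\frac{k}{n}S_n^{(d)}$ for $0\le k\le n$, and $\mathcal{B}_n^{(d)}=\{B_0^{(d)},\ldots,B_n^{(d)}\}\subset\mathbb{R}^d$. Then, as $d\to\infty$, the random metric space $\big(n^{-1/2}\mathcal{B}_n^{(d)},\|\cdot\|\big)$ converges in probability, in the Gromov--Hausdorff sense, to the space $[0,1]$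 with the pseudo-metric $(s,t)\mapsto\sqrt{(1-|t-s|)\,|t-s|}$.
   Context: $\|\cdot\|$ is the Euclidean norm on $\mathbb{R}^d$; a finite subset of $\mathbb{R}^d$ is regarded as a metric space with the induced Euclidean metric, and $n^{-1/2}\mathcal{B}_n^{(d)}=\{n^{-1/2}x:x\in\mathcal{B}_n^{(d)}\}$. For metric spaces $\mathbb{X}=(X,\rho_X)$, $\mathbb{Y}=(Y,\rho_Y)$, the Gromov--Hausdorff distance is $d_{GH}(\mathbb{X},\mathbb{Y})=\inf d_H(i(X),j(Y))$, the infimum being over all metric spaces $(Z,d)$ and all isometric embeddings $i:X\to Z$, $j:Y\to Z$, where $d_H(A,B)=\inf\{\epsilon>0: A\subset B^\epsilon,\ B\subset A^\epsilon\}$ is the Hausdorff distance in $(Z,d)$ and $A^\epsilon=\{x:d(x,A)<\epsilon\}$. A pseudo-metric space is treated, for the purposes of the Gromov--Hausdorff distance, as the metric space obtained by identifying points at pseudo-distance $0$. Convergence in probability in the Gromov--Hausdorff sense to a deterministic space means that the Gromov--Hausdorff distance to that space converges to $0$ in probability. *)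

(* Defs.v *)
From HB Require Import structures.
From mathcomp Require Import all_boot all_order all_algebra generic_quotient finmap.
From mathcomp Require Import all_classical all_reals all_analysis.
From mathcomp Require Import ring lra.

Set Implicit Arguments.
Unset Strict Implicit.
Unset Printing Implicit Defensive.

Import Order.TTheory GRing.Theory Num.Theory.
Import numFieldNormedType.Exports.

Local Open Scope classical_set_scope.
Local Open Scope ring_scope.

(* The matrix type 'rV[R]_d carries the sup norm in the library, hence the
   alias. *)
Definition euclid (R : realType) (d : nat) : Type := 'rV[R]_d.

HB.instance Definition _ (R : realType) (d : nat) :=
  GRing.Lmodule.copy (euclid R d) 'rV[R]_d.

Definition enorm (R : realType) (d : nat) (x : euclid R d) : R :=
  Num.sqrt (\sum_(k < d) x 0 k ^+ 2).

Section euclid_metric.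
Context (R : realType) (d : nat).
Implicit Types x y z : euclid R d.

Let dist x y : R := enorm (x - y).

Let dist_refl x : dist x x = 0.
Proof.
rewrite /dist /enorm subrr big1 ?sqrtr0// => k _.
by rewrite mxE expr0n.
Qed.

Let dist_pos x y : dist x y = 0 -> x = y.
Proof.
move=> /eqP; rewrite sqrtr_eq0 => le0.
have eq0 : \sum_(k < d) (x - y) 0 k ^+ 2 = 0.
  by apply/eqP; rewrite eq_le le0 sumr_ge0// => k _; exact: sqr_ge0.
apply/rowP => k; apply/eqP; rewrite -subr_eq0 -sqrf_eq0.
have := eq0 => /psumr_eq0P => /(_ (fun i _ => sqr_ge0 _)) => /(_ k isT).
by rewrite !mxE => ->.
Qed.

Let dist_sym x y : dist x y = dist y x.
Proof.
rewrite /dist /enorm; congr Num.sqrt; apply: eq_bigr => k _.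
by rewrite -opprB mxE sqrrN.
Qed.

Let cauchy_schwarz x y : (\sum_(k < d) x 0 k * y 0 k) ^+ 2 <=
  (\sum_(k < d) x 0 k ^+ 2) * (\sum_(k < d) y 0 k ^+ 2).
Proof.
set a := \sum_(k < d) x 0 k ^+ 2; set c := \sum_(k < d) y 0 k ^+ 2.
set b := \sum_(k < d) x 0 k * y 0 k.
have a0 : 0 <= a by apply: sumr_ge0 => k _; exact: sqr_ge0.
have c0 : 0 <= c by apply: sumr_ge0 => k _; exact: sqr_ge0.
have pos s t : 0 <= s ^+ 2 * a + 2 * s * t * b + t ^+ 2 * c.
  rewrite /a /b /c !mulr_sumr -!big_split/= sumr_ge0// => k _.
  have -> : s ^+ 2 * x 0 k ^+ 2 + 2 * s * t * (x 0 k * y 0 k) +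
    t ^+ 2 * y 0 k ^+ 2 = (s * x 0 k + t * y 0 k) ^+ 2 by ring.
  exact: sqr_ge0.
have [a_eq0|a_neq0] := eqVneq a 0.
  have x0 k : x 0 k = 0.
    apply/eqP; rewrite -sqrf_eq0; apply/eqP.
    by move: a_eq0 => /psumr_eq0P => /(_ (fun i _ => sqr_ge0 _)); exact.
  rewrite /b big1 ?expr0n ?mulr_ge0// => k _.
  by rewrite x0 mul0r.
have a_gt0 : 0 < a by rewrite lt_def a_neq0.
have := pos (- b) a.
rewrite (_ : _ + _ = a * (a * c - b ^+ 2)); last by ring.
by rewrite pmulr_rge0// subr_ge0.
Qed.

Let dist_triangle y x z : dist x z <= dist x y + dist y z.
Proof.
rewrite /dist /enorm; set u := x - y; set v := y - z.
have -> : x - z = u + v by rewrite /u /v addrA subrK.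
set a := \sum_(k < d) u 0 k ^+ 2; set c := \sum_(k < d) v 0 k ^+ 2.
have a0 : 0 <= a by apply: sumr_ge0 => k _; exact: sqr_ge0.
have c0 : 0 <= c by apply: sumr_ge0 => k _; exact: sqr_ge0.
rewrite -[leRHS]ger0_norm ?addr_ge0 ?sqrtr_ge0// -sqrtr_sqr ler_wsqrtr//.
rewrite sqrrD !sqr_sqrtr//.
have -> : \sum_(k < d) (u + v) 0 k ^+ 2 =
    a + (\sum_(k < d) u 0 k * v 0 k) *+ 2 + c.
  rewrite /a /c -sumrMnl -!big_split/=; apply: eq_bigr => k _.
  by rewrite mxE sqrrD.
rewrite lerD2r lerD2l lerMn2r -sqrtrM//=.
apply: (le_trans (ler_norm _)); rewrite -sqrtr_sqr ler_wsqrtr//.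
Qed.

HB.instance Definition _ := @isMetric.Build R (euclid R d) dist
  dist_refl dist_pos dist_sym dist_triangle.

End euclid_metric.

(* The Borel sigma-algebra of R^d. *)
HB.instance Definition _ (R : realType) (d : nat) :=
  Measurable.copy (euclid R d) (g_sigma_algebraType (@open (euclid R d))).

Section subset_metric.
Context (R : realType) (T : metricType R) (A : set T).

Let dist (x y : A) : R := mdist (val x) (val y).

Let dist_ge0 x y : 0 <= dist x y. Proof. exact: mdist_ge0. Qed.

Let dist_pos x y : dist x y = 0 -> x = y.
Proof. by move/mdist_positivity/val_inj. Qed.

Let dist_ball (x : A) (e : R) : ball x e = [set y | dist x y < e].
Proof.
by rewrite -[LHS]/(val @^-1` ball (val x) e) ballEmdist.
Qed.

HB.instance Definition _ :=
  @PseudoMetric_isMetric.Build R (set_type A) dist dist_ge0 dist_pos dist_ball.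

End subset_metric.

Record pseudo_dist (R : realType) (T : Type) := PseudoDist {
  pdist :> T -> T -> R ;
  pdistxx : forall x, pdist x x = 0 ;
  pdist_sym : forall x y, pdist x y = pdist y x ;
  pdist_triangle : forall y x z, pdist x z <= pdist x y + pdist y z
}.

(* The metric space obtained from (T, rho) by identifying points at
   pseudo-distance 0. *)
Section metric_identification.
Local Open Scope quotient_scope.
Context (R : realType) (T : choiceType) (rho : pseudo_dist R T).

Lemma pdist_ge0 x y : 0 <= rho x y.
Proof.
have := pdist_triangle rho y x x.
by rewrite pdistxx (pdist_sym rho y x) -mulr2n pmulrn_lge0.
Qed.

Let eqv x y := rho x y == 0.

Let eqv_refl : reflexive eqv.
Proof. by move=> x; rewrite /eqv pdistxx. Qed.

Let eqv_sym : symmetric eqv.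
Proof. by move=> x y; rewrite /eqv pdist_sym. Qed.

Let eqv_trans : transitive eqv.
Proof.
move=> y x z /eqP xy /eqP yz; rewrite /eqv eq_le pdist_ge0 andbT.
by have := pdist_triangle rho y x z; rewrite xy yz addr0.
Qed.

Canonical pdist_equiv := EquivRel eqv eqv_refl eqv_sym eqv_trans.

Definition metric_identification : Type := {eq_quot pdist_equiv}.

HB.instance Definition _ := Choice.copy metric_identification
  {eq_quot pdist_equiv}.
HB.instance Definition _ := Quotient.copy metric_identification
  {eq_quot pdist_equiv}.

Let dist (x y : metric_identification) : R := rho (repr x) (repr y).

Let dist_refl x : dist x x = 0.
Proof. exact: pdistxx. Qed.

Let dist_pos x y : dist x y = 0 -> x = y.
Proof.
move=> /eqP xy; rewrite -(reprK x) -(reprK y).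
exact/eqquotP.
Qed.

Let dist_sym x y : dist x y = dist y x.
Proof. exact: pdist_sym. Qed.

Let dist_triangle y x z : dist x z <= dist x y + dist y z.
Proof. exact: pdist_triangle. Qed.

HB.instance Definition _ := @isMetric.Build R metric_identification dist
  dist_refl dist_pos dist_sym dist_triangle.

End metric_identification.

Section gromov_hausdorff.
Context (R : realType).
Local Open Scope ereal_scope.

Definition point_set_dist (Z : metricType R) (x : Z) (A : set Z) : \bar R :=
  ereal_inf [set (mdist x a)%:E | a in A].

Definition open_thickening (Z : metricType R) (A : set Z) (e : R) : set Z :=
  [set x | point_set_dist x A < e%:E].

Definition hausdorff_dist (Z : metricType R) (A B : set Z) : \bar R :=
  ereal_inf [set e%:E | e in [set e : R | [/\ (0 < e)%R,
    A `<=` open_thickening B e & B `<=` open_thickening A e]]].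

Definition isometric_embedding (X Z : metricType R) (i : X -> Z) : Prop :=
  forall x y, mdist (i x) (i y) = mdist x y.

Definition gromov_hausdorff_dist (X Y : metricType R) : \bar R :=
  ereal_inf [set h | exists (Z : metricType R) (i : X -> Z) (j : Y -> Z),
    [/\ isometric_embedding i, isometric_embedding j &
        h = hausdorff_dist (range i) (range j)]].

End gromov_hausdorff.

Section limit_space.
Context (R : realType).

Definition unit_interval : Type := set_type (`[0, 1]%classic : set R).
HB.instance Definition _ := Choice.on unit_interval.

Let rho (s t : unit_interval) : R :=
  Num.sqrt ((1 - `|val t - val s|) * `|val t - val s|).

Let rho_refl s : rho s s = 0.
Proof. by rewrite /rho subrr normr0 mulr0 sqrtr0. Qed.

Let rho_sym s t : rho s t = rho t s.
Proof. by rewrite /rho distrC. Qed.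

Let rho_triangle t s u : rho s u <= rho s t + rho t u.
Proof.
have bnd (x : unit_interval) : 0 <= val x <= 1.
  by have := set_valP x; rewrite /= in_itv.
have [/andP[s0 s1] /andP[t0 t1] /andP[u0 u1]] := And3 (bnd s) (bnd t) (bnd u).
rewrite /rho; move: (val s) (val t) (val u) s0 s1 t0 t1 u0 u1 => {}s {}t {}u.
move=> s0 s1 t0 t1 u0 u1.
have itv (x y : R) : 0 <= x -> x <= 1 -> 0 <= y -> y <= 1 ->
    0 <= `|x - y| <= 1.
  by move=> *; rewrite normr_ge0 ler_norml; apply/andP; split; lra.
have /andP[a0 a1] := itv t s t0 t1 s0 s1.
have /andP[b0 b1] := itv u t u0 u1 t0 t1.
have abc : [\/ `|u - s| = `|t - s| + `|u - t|, `|t - s| = `|u - s| + `|u - t|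
  | `|u - t| = `|u - s| + `|t - s| ].
{ have [ts|ts] := lerP s t; have [ut|ut] := lerP t u; have [us|us] := lerP s u;
  rewrite ?(ger0_norm, ltr0_norm, subr_ge0, subr_lt0)//.
  all: by first [apply: Or31; lra | apply: Or32; lra | apply: Or33; lra | lra]. }
have /andP[c0 c1] := itv u s u0 u1 s0 s1.
move: (`|t - s|) (`|u - t|) (`|u - s|) a0 a1 b0 b1 c0 c1 abc => a b c.
move=> a0 a1 b0 b1 c0 c1 abc.
have A0 : 0 <= (1 - a) * a by rewrite mulr_ge0// subr_ge0.
have B0 : 0 <= (1 - b) * b by rewrite mulr_ge0// subr_ge0.
rewrite -[leRHS]ger0_norm ?addr_ge0 ?sqrtr_ge0// -sqrtr_sqr ler_wsqrtr//.
rewrite sqrrD !sqr_sqrtr//.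
apply: (@le_trans _ _ ((1 - a) * a + (1 - b) * b)).
  by case: abc => abc; nra.
rewrite addrAC lerDl mulrn_wge0// mulr_ge0// sqrtr_ge0//.
Qed.

Definition limit_pseudo_dist : pseudo_dist R unit_interval :=
  PseudoDist rho_refl rho_sym rho_triangle.

Definition limit_space : metricType R :=
  metric_identification limit_pseudo_dist.

End limit_space.

Section probability.
Context (R : realType) (dO : measure_display) (Omega : measurableType dO).
Context (P : probability Omega R).

Definition mutually_independent (dT : measure_display) (T : measurableType dT)
    (X : nat -> {RV P >-> T}) : Prop :=
  forall (J : {fset nat}) (A : nat -> set T),
    (forall i, measurable (A i)) ->
    P (\bigcap_(i in [set` J]) (X i @^-1` A i)) =
      (\prod_(i <- J) P (X i @^-1` A i))%E.

Definition iid (dT : measure_display) (T : measurableType dT)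
    (X : nat -> {RV P >-> T}) : Prop :=
  mutually_independent X /\
  forall i (A : set T), measurable A ->
    distribution P (X i) A = distribution P (X 0%N) A.

End probability.

(* The increments are indexed from 0: X i stands for X_{i+1}. *)
Section bridge.
Context (R : realType) (d : nat) (Omega : Type).
Context (X : nat -> Omega -> euclid R d).

Definition walk (k : nat) (w : Omega) : euclid R d := \sum_(i < k) X i w.

Definition bridge (n k : nat) (w : Omega) : euclid R d :=
  walk k w - (k%:R / n%:R) *: walk n w.

Definition bridge_range (n : nat) (w : Omega) : set (euclid R d) :=
  [set bridge n k w | k in [set k | (k <= n)%N]].

Definition scaled_bridge_range (n : nat) (w : Omega) : set (euclid R d) :=
  [set (Num.sqrt n%:R)^-1 *: x | x in bridge_range n w].

Definition bridge_space (n : nat) (w : Omega) : metricType R :=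
  set_type (scaled_bridge_range n w).

End bridge.

Definition cvg_gh_in_probability (R : realType) (disp : nat -> measure_display)
    (Omega : forall d, measurableType (disp d))
    (P : forall d, probability (Omega d) R)
    (Y : forall d, Omega d -> metricType R) (Z : metricType R) : Prop :=
  forall eps : R, 0 < eps ->
    P d [set w | (eps%:E < gromov_hausdorff_dist (Y d w) Z)%E]
      @[d --> \oo] --> 0%E.

(* Main.v *)
(** Write |S_k - S_a|^2 as the sum of the |X_i|^2, a <= i < k, plus twice the sum
    of the cross terms <X_j, S_j - S_a>.  For fixed a the cross terms are
    orthogonal martingale differences of second moment at most j max_k E X_(1,k)^2,
    which is o(n), so the maximal inequality makes their partial sums o(n) in
    probability uniformly in k <= n.  The sums of the |X_i|^2 obey a uniform weak
    law: the truncated variables satisfy the maximal inequality, and the rest is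
    monotone and small in mean by uniform integrability.  Letting a run through a
    fixed number of grid points yields |S_j - S_i|^2 = (j - i) + o(n) uniformly in
    i <= j <= n.  The squared distances of the bridge are an affine function of
    those of the walk, hence are n t (1 - t) + o(n) with t = (j - i) / n, and the
    correspondence relating B_i to the s with |s - i / n| <= 1 / n bounds the
    Gromov-Hausdorff distance. *)

Require Import Defs.
From HB Require Import structures.
From mathcomp Require Import all_boot all_order all_algebra generic_quotient finmap.
From mathcomp Require Import all_classical all_reals all_analysis.
From mathcomp Require Import measurable_realfun ring lra.

Set Implicit Arguments.
Unset Strict Implicit.
Unset Printing Implicit Defensive.

Import Order.TTheory GRing.Theory Num.Theory.
Import numFieldNormedType.Exports.

Local Open Scope classical_set_scope.
Local Open Scope ring_scope.

(** * Gromov-Hausdorff distance and correspondences *)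

(** The grid is forced by the absence of a rate in (d). For one starting point the maximal
    inequality costs [s / c ^+ 2], where [s] bounds the coordinate variances and may tend to 0 very
    slowly compared with [n]; a union over all [n] starting points is out of reach, but one over [m]
    points, with [m] fixed by the accuracy alone, is affordable. Off the grid no further probability
    is spent: the triangle inequality is enough, because the distance from a grid point is
    controlled uniformly in the other endpoint.

    Truncation is needed because only second moments of the norms are available, so the squared
    norms may have no variance. The cross terms avoid this, since independence separates an
    increment from the next step.

    No conditional expectation is used: martingale differences are variables orthogonal to the
    square-integrable functions of the past. The Gromov-Hausdorff distance is an infimum over all
    metric spaces, so the measurability of its level sets, required for the monotonicity of [P], is
    a question of its own. *)

Lemma mdist_pi (R : realType) (T : choiceType) (rho : pseudo_dist R T) (u v : T) :
  mdist (\pi_(metric_identification rho) u)%qT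
        (\pi_(metric_identification rho) v)%qT = rho u v.
Proof.
(* The quotient metric is computed on representatives, which lie at pseudo-distance 0 from the
   original points. *)
have reprE x : rho (repr (\pi_(metric_identification rho) x)%qT) x = 0.
  have : (repr (\pi_(metric_identification rho) x)%qT = x
    %[mod metric_identification rho])%qT by rewrite reprK.
  by move/eqquotP/eqP.
rewrite [LHS](_ : _ = rho (repr (\pi_(metric_identification rho) u)%qT)
  (repr (\pi_(metric_identification rho) v)%qT)) //.
move: (reprE u) (reprE v).
set u' := repr (_ u); set v' := repr (_ v) => ru rv.
have := pdist_triangle rho u u' v'; have := pdist_triangle rho v u v'.
have := pdist_triangle rho u' u v; have := pdist_triangle rho v' u' v.
rewrite (pdist_sym rho v v') (pdist_sym rho u u').
by move=> *; apply/eqP; rewrite eq_le; apply/andP; split; lra.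
Qed.

Lemma hausdorff_le (R : realType) (Z : metricType R) (A B : set Z) (r : R) :
  0 < r -> (forall x, A x -> exists2 y, B y & mdist x y <= r) ->
  (forall y, B y -> exists2 x, A x & mdist y x <= r) ->
  (hausdorff_dist A B <= r%:E)%E.
Proof.
move=> r0 AB BA; apply/lee_addgt0Pr => e e0; apply: ereal_inf_lbound => /=.
have thick C D : (forall x, C x -> exists2 y, D y & mdist x y <= r) ->
    C `<=` @open_thickening _ Z D (r + e).
  move=> CD x /CD[y Dy xy]; rewrite /open_thickening/= /point_set_dist.
  apply: (@le_lt_trans _ _ (mdist x y)%:E); last by rewrite lte_fin; lra.
  by apply: ereal_inf_lbound; exists y.
exists (r + e) => //; split; [lra | exact: thick | exact: thick].
Qed.

Lemma hausdorff_lt (R : realType) (Z : metricType R) (A B : set Z) (r : R) :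
  (hausdorff_dist A B < r%:E)%E ->
  (forall x, A x -> exists2 y, B y & mdist x y < r) /\
  (forall y, B y -> exists2 x, A x & mdist y x < r).
Proof.
move=> /ereal_inf_lt[_ [e [e0 AB BA] <-]]; rewrite lte_fin => er.
have near_of C D : C `<=` @open_thickening _ Z D e ->
    forall x, C x -> exists2 y, D y & mdist x y < r.
  move=> CD x /CD; rewrite /open_thickening/= => /ereal_inf_lt[_ [y Dy <-]].
  by rewrite lte_fin => xy; exists y => //; exact: lt_trans er.
by split; exact: near_of.
Qed.

Section gluing.
Context (R : realType) (X Y : metricType R) (I J : Type).
Context (p : I -> X) (q : J -> Y) (Rel : I -> J -> Prop) (r : R).
Hypothesis p_surj : forall x, exists i, p i = x.
Hypothesis q_surj : forall y, exists j, q j = y.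
Hypothesis Rel_l : forall i, exists j, Rel i j.
Hypothesis Rel_r : forall j, exists i, Rel i j.
Hypothesis r_gt0 : 0 < r.
Hypothesis Rel_dist : forall i i' j j', Rel i j -> Rel i' j' ->
  `|mdist (p i) (p i') - mdist (q j) (q j')| <= 2 * r.

(** The disjoint union is metrized by travelling from [x] to [y] through one related pair, the
    passage itself costing [r]. Relating indices rather than points keeps [p] and [q] free to be
    non-injective. *)
Let cross_set (x : X) (y : Y) : set R :=
  [set c | exists i j, Rel i j /\ c = mdist x (p i) + r + mdist (q j) y].

Let cross x y := inf (cross_set x y).

Let cross_ge_r x y c : cross_set x y c -> r <= c.
Proof.
by move=> [i [j [_ ->]]]; rewrite addrAC lerDr addr_ge0// mdist_ge0.
Qed.

Let cross_has_inf x y : has_inf (cross_set x y).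
Proof.
split; last by exists r => c; exact: cross_ge_r.
have [i _] := p_surj x; have [j ij] := Rel_l i.
by exists (mdist x (p i) + r + mdist (q j) y), i, j.
Qed.

Let le_cross x y a : (forall i j, Rel i j ->
  a <= mdist x (p i) + r + mdist (q j) y) -> a <= cross x y.
Proof.
move=> H; apply: lb_le_inf; first exact: (cross_has_inf x y).1.
by move=> c [i [j [ij ->]]]; exact: H.
Qed.

Let cross_le x y i j : Rel i j -> cross x y <= mdist x (p i) + r + mdist (q j) y.
Proof.
move=> ij; apply: ge_inf; first exact: (cross_has_inf x y).2.
by exists i, j.
Qed.

Let glue (u v : X + Y) : R :=
  match u, v with
  | inl x, inl x' => mdist x x'
  | inr y, inr y' => mdist y y'
  | inl x, inr y => cross x y
  | inr y, inl x => cross x y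
  end.

Let glue_refl u : glue u u = 0.
Proof. by case: u => z /=; rewrite mdistxx. Qed.

Let glue_sym u v : glue u v = glue v u.
Proof. by case: u v => [x|y] [x'|y']//=; rewrite metric_sym. Qed.

Let cross_tri_l x x' y : cross x y <= mdist x x' + cross x' y.
Proof.
rewrite -lerBlDl; apply: le_cross => i j ij; rewrite lerBlDl !addrA.
apply: (le_trans (cross_le _ _ ij)); rewrite !lerD2r.
exact: metric_triangle.
Qed.

Let cross_tri_r x y y' : cross x y <= cross x y' + mdist y' y.
Proof.
rewrite -lerBlDr; apply: le_cross => i j ij; rewrite lerBlDr -addrA.
by apply: (le_trans (cross_le _ _ ij)); rewrite lerD2l; exact: metric_triangle.
Qed.

Let tri_cross_l x x' y : mdist x x' <= cross x y + cross x' y.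
Proof.
rewrite -lerBlDr; apply: le_cross => i j ij.
rewrite lerBlDl -lerBlDr; apply: le_cross => i' j' ij'.
(* A detour through the other space crosses twice and so pays [2 * r], which is exactly the allowed
   distortion. *)
have := Rel_dist ij ij'; rewrite ler_norml => /andP[_].
have := metric_triangle x (p i) x'.
have := metric_triangle (p i) (p i') x'.
have := metric_triangle (q j) y (q j').
rewrite (metric_sym (p i') x') (metric_sym y (q j')).
lra.
Qed.

Let tri_cross_r x y y' : mdist y y' <= cross x y + cross x y'.
Proof.
rewrite -lerBlDr; apply: le_cross => i j ij.
rewrite lerBlDl -lerBlDr; apply: le_cross => i' j' ij'.
have := Rel_dist ij ij'; rewrite ler_norml => /andP[+ _].
have := metric_triangle y (q j) y'.
have := metric_triangle (q j) (q j') y'.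
have := metric_triangle (p i) x (p i').
rewrite (metric_sym (p i) x) (metric_sym y (q j)).
lra.
Qed.

Let glue_triangle v u w : glue u w <= glue u v + glue v w.
Proof.
case: u v w => [x|y] [x'|y'] [x''|y'']/=.
- exact: metric_triangle.
- exact: cross_tri_l.
- exact: tri_cross_l.
- exact: cross_tri_r.
- by rewrite addrC metric_sym; exact: cross_tri_l.
- exact: tri_cross_r.
- by rewrite addrC metric_sym; exact: cross_tri_r.
- exact: metric_triangle.
Qed.

Let glue_pdist := PseudoDist glue_refl glue_sym glue_triangle.

(** Passing to the quotient spares a proof of definiteness, and by [mdist_pi] it leaves the
    distances unchanged. *)
Let gluing : metricType R := metric_identification glue_pdist.

Let mdist_glue (u v : X + Y) :
  mdist (\pi_gluing u)%qT (\pi_gluing v)%qT = glue u v.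
Proof. exact: mdist_pi. Qed.

Lemma gh_le_of_corr : (gromov_hausdorff_dist X Y <= r%:E)%E.
Proof.
pose i x : gluing := (\pi_gluing (inl x))%qT.
pose j y : gluing := (\pi_gluing (inr y))%qT.
apply: (@le_trans _ _ (hausdorff_dist (range i) (range j))).
  apply: ereal_inf_lbound; exists gluing, i, j.
  by split => // x y; rewrite mdist_glue.
have cross_r a b : Rel a b -> cross (p a) (q b) <= r.
  by move=> ab; apply: (le_trans (cross_le _ _ ab)); rewrite !mdistxx add0r addr0.
apply: hausdorff_le => //.
- move=> _ [x _ <-]; have [a <-] := p_surj x; have [b ab] := Rel_l a.
  by exists (j (q b)); [exists (q b)|rewrite mdist_glue/= cross_r].
- move=> _ [y _ <-]; have [b <-] := q_surj y; have [a ab] := Rel_r b.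
  by exists (i (p a)); [exists (p a)|rewrite mdist_glue/= cross_r].
Qed.

End gluing.

(** Points are related when their images in a common space are closer than [r]. Since the relation
    lives on indices, it can be reused for another space indexed by [I], which is what
    [bridge_gh_lipschitz] does. *)
Lemma corr_of_gh_lt (R : realType) (X Y : metricType R) (I J : Type)
    (p : I -> X) (q : J -> Y) (r : R) :
  (forall x, exists i, p i = x) -> (forall y, exists j, q j = y) ->
  (gromov_hausdorff_dist X Y < r%:E)%E ->
  exists Rel : I -> J -> Prop, [/\ forall i, exists j, Rel i j,
    forall j, exists i, Rel i j &
    forall i i' j j', Rel i j -> Rel i' j' ->
      `|mdist (p i) (p i') - mdist (q j) (q j')| <= 2 * r].
Proof.
move=> p_surj q_surj /ereal_inf_lt[_ [Z [f [g [fi gi ->]]]] /hausdorff_lt[fg gf]].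
exists (fun i j => mdist (f (p i)) (g (q j)) < r); split.
- move=> i; have [_ [y _ <-] xy] := fg (f (p i)) (imageT _ _).
  by have [j qj] := q_surj y; exists j; rewrite qj.
- move=> j; have [_ [x _ <-] xy] := gf (g (q j)) (imageT _ _).
  by have [i pi] := p_surj x; exists i; rewrite pi metric_sym.
- move=> i i' j j' ij ij'; rewrite -fi -gi.
  have := metric_triangle (f (p i)) (g (q j)) (f (p i')).
  have := metric_triangle (g (q j)) (g (q j')) (f (p i')).
  have := metric_triangle (g (q j)) (f (p i)) (g (q j')).
  have := metric_triangle (f (p i)) (f (p i')) (g (q j')).
  rewrite (metric_sym (g (q j)) (f (p i))) (metric_sym (g (q j')) (f (p i'))).
  by rewrite ler_norml => *; apply/andP; split; lra.
Qed.

(** * Euclidean norms and distances between bridge points *)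

Section euclidean.
Context (R : realType) (d : nat).
Implicit Types x y : euclid R d.

Definition dotp x y : R := \sum_(k < d) x 0 k * y 0 k.

Lemma enorm_ge0 x : 0 <= enorm x.
Proof. exact: sqrtr_ge0. Qed.

Lemma sqr_enorm x : enorm x ^+ 2 = \sum_(k < d) x 0 k ^+ 2.
Proof. by rewrite sqr_sqrtr// sumr_ge0// => k _; exact: sqr_ge0. Qed.

Lemma mdist_euclid x y : mdist x y = enorm (x - y).
Proof. by []. Qed.

Lemma enormN x : enorm (- x) = enorm x.
Proof. by congr Num.sqrt; apply: eq_bigr => k _; rewrite mxE sqrrN. Qed.

Lemma enormZ (c : R) x : enorm (c *: x) = `|c| * enorm x.
Proof.
rewrite /enorm -sqrtr_sqr -sqrtrM ?sqr_ge0//; congr Num.sqrt.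
by rewrite mulr_sumr; apply: eq_bigr => k _; rewrite mxE exprMn.
Qed.

Lemma sqr_enormD x y :
  enorm (x + y) ^+ 2 = enorm x ^+ 2 + 2 * dotp x y + enorm y ^+ 2.
Proof.
rewrite !sqr_enorm /dotp mulr_sumr -!big_split/=; apply: eq_bigr => k _.
by rewrite mxE; ring.
Qed.

Lemma coord_le_enorm x k : `|x 0 k| <= enorm x.
Proof.
rewrite -sqrtr_sqr ler_wsqrtr// (bigD1 k)//= lerDl sumr_ge0// => i _.
exact: sqr_ge0.
Qed.

Lemma ler_enormB x y z : `|enorm (x - z) - enorm (y - z)| <= enorm (x - y).
Proof.
have := metric_triangle x y z; have := metric_triangle y x z.
rewrite (metric_sym y x) !mdist_euclid => *.
by rewrite ler_norml; apply/andP; split; lra.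
Qed.

End euclidean.

Section bridge_distances.
Context (R : realType) (d : nat) (Omega : Type).
Context (X : nat -> Omega -> euclid R d) (w : Omega).

Lemma walk0 : walk X 0 w = 0.
Proof. by rewrite /walk big_ord0. Qed.

Lemma walkS k : walk X k.+1 w = walk X k w + X k w.
Proof. by rewrite /walk big_ord_recr. Qed.

Definition sqdist (a b : nat) : R := enorm (walk X b w - walk X a w) ^+ 2.

(** The bridge increment is [S_j - S_i - t S_n]. Polarization turns the inner product of [S_j - S_i]
    with [S_n] into squared distances between the points 0, [S_i], [S_j] and [S_n] of the walk. *)
Lemma sqr_bridge_dist n i j (t := (j%:R - i%:R) / n%:R : R) :
  enorm (bridge X n j w - bridge X n i w) ^+ 2 =
  sqdist i j - t * (sqdist 0 j - sqdist j n - sqdist 0 i + sqdist i n)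
  + t ^+ 2 * sqdist 0 n.
Proof.
rewrite /sqdist !sqr_enorm -!sumrB -!big_split/= !mulr_sumr -!sumrB -!big_split/=.
apply: eq_bigr => k _; rewrite walk0 /bridge !mxE /t.
by ring.
Qed.

Lemma sqr_bridge_dist_near n (e : R) : (0 < n)%N ->
  (forall a b, (a <= b <= n)%N -> `|sqdist a b - (b%:R - a%:R)| <= e * n%:R) ->
  forall i j, (i <= j <= n)%N ->
  `|enorm (bridge X n j w - bridge X n i w) ^+ 2 / n%:R -
    (1 - `|j%:R / n%:R - i%:R / n%:R|) * `|j%:R / n%:R - i%:R / n%:R| | <= 6 * e.
Proof.
move=> n0 H i j /andP[ij jn]; have in' := leq_trans ij jn.
have n0' : 0 < n%:R :> R by rewrite ltr0n.
have [Hij H0j Hjn] : [/\ (i <= j <= n)%N, (0 <= j <= n)%N & (j <= n <= n)%N].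
  by rewrite ij jn leqnn.
have [H0i Hin H0n] : [/\ (0 <= i <= n)%N, (i <= n <= n)%N & (0 <= n <= n)%N].
  by rewrite in' leqnn.
move: {H Hij H0j Hjn H0i Hin H0n} (H _ _ Hij) (H _ _ H0j) (H _ _ Hjn) (H _ _ H0i)
  (H _ _ Hin) (H _ _ H0n).
rewrite sqr_bridge_dist.
set t := (j%:R - i%:R) / n%:R.
have t0 : 0 <= t by rewrite divr_ge0 ?ler0n// subr_ge0 ler_nat.
have t1 : t <= 1 by rewrite ler_pdivrMr// mul1r lerBlDr ler_wpDr// ler_nat.
rewrite -mulrBl -/t (ger0_norm t0) !subr0.
have jE : j%:R = i%:R + t * n%:R :> R by rewrite /t divfK ?gt_eqF// addrC subrK.
rewrite jE.
move: (sqdist i j) (sqdist 0 j) (sqdist j n) (sqdist 0 i) (sqdist i n) (sqdist 0 n).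
move=> A B C D E F hA hB hC hD hE hF.
rewrite -(ler_pM2r n0') -[X in _ * X <= _](ger0_norm (ltW n0')) -normrM mulrBl divfK ?gt_eqF//.
(* Replacing each squared distance by its target value leaves
   [t n - t (2 t n) + t^2 n = t (1 - t) n]. The six remaining errors carry weights at most 1, hence
   the constant 6. *)
have -> : A - t * (B - C - D + E) + t ^+ 2 * F - (1 - t) * t * n%:R =
  (A - (i%:R + t * n%:R - i%:R)) - t * ((B - (i%:R + t * n%:R)) -
   (C - (n%:R - (i%:R + t * n%:R))) - (D - i%:R) + (E - (n%:R - i%:R))) +
   t ^+ 2 * (F - n%:R) by ring.
move: hA hB hC hD hE hF.
move: (A - _) (B - _) (C - _) (D - _) (E - _) (F - n%:R) => {}A {}B {}C {}D {}E {}F.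
move=> hA hB hC hD hE hF.
have -> : 6 * e * n%:R = e * n%:R + 1 * (4 * (e * n%:R)) + 1 * (e * n%:R) by ring.
apply: (le_trans (ler_normD _ _)); apply: lerD.
  apply: (le_trans (ler_normB _ _)); apply: lerD => //.
  rewrite normrM ger0_norm// ler_pM//.
  by move: hB hC hD hE; rewrite !ler_norml => /andP[? ?] /andP[? ?] /andP[? ?]
    /andP[? ?]; apply/andP; split; lra.
by rewrite normrM ger0_norm ?sqr_ge0// ler_pM ?sqr_ge0// expr_le1.
Qed.

End bridge_distances.

Lemma ler_sqrtB (R : realType) (x y : R) : 0 <= x -> 0 <= y ->
  `|Num.sqrt x - Num.sqrt y| <= Num.sqrt `|x - y|.
Proof.
wlog xy : x y / y <= x.
  move=> H x0 y0; have [/H|/ltW/H] := leP y x; first exact.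
  by rewrite distrC (distrC x); exact.
move=> x0 y0; rewrite !ger0_norm ?subr_ge0 ?ler_wsqrtr//.
rewrite lerBlDr -[leRHS]ger0_norm ?addr_ge0 ?sqrtr_ge0// -sqrtr_sqr ler_wsqrtr//.
rewrite sqrrD !sqr_sqrtr ?subr_ge0// addrAC subrK lerDl mulrn_wge0// mulr_ge0// sqrtr_ge0//.
Qed.

(** * Gromov-Hausdorff distance from the bridge to the limit *)

Section bridge_space_points.
Context (R : realType) (d : nat) (Omega : Type).
Context (X : nat -> Omega -> euclid R d).

Definition bridge_dist (n i j : nat) (w : Omega) : R :=
  enorm (bridge X n j w - bridge X n i w) / Num.sqrt n%:R.

Lemma bridge_dist_sym n i j w : bridge_dist n i j w = bridge_dist n j i w.
Proof. by rewrite /bridge_dist -[bridge X n i w - _]opprB enormN. Qed.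

Lemma bridge_point_subproof n w (i : 'I_n.+1) :
  (Num.sqrt n%:R)^-1 *: bridge X n i w \in scaled_bridge_range X n w.
Proof.
by apply/mem_set; exists (bridge X n i w) => //; exists i => //=; rewrite -ltnS.
Qed.

Definition bridge_point n w (i : 'I_n.+1) : bridge_space X n w :=
  exist (fun x => x \in scaled_bridge_range X n w) _ (bridge_point_subproof w i).

Lemma bridge_point_surj n w (x : bridge_space X n w) :
  exists i, bridge_point w i = x.
Proof.
case: x => x xP; have := set_mem xP => -[_ [k /= kn <-] xE].
by exists (Ordinal (kn : (k < n.+1)%N)); apply: val_inj.
Qed.

Lemma mdist_bridge_point n w (i j : 'I_n.+1) :
  mdist (bridge_point w i) (bridge_point w j) = bridge_dist n i j w.
Proof.
rewrite (_ : mdist _ _ = enorm ((Num.sqrt n%:R)^-1 *: bridge X n i w -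
  (Num.sqrt n%:R)^-1 *: bridge X n j w))//.
rewrite -scalerBr enormZ ger0_norm ?invr_ge0 ?sqrtr_ge0// mulrC.
exact: bridge_dist_sym.
Qed.

End bridge_space_points.

Lemma limit_point_surj (R : realType) (y : limit_space R) :
  exists s, (\pi_(limit_space R) s)%qT = y.
Proof. by exists (repr y); rewrite reprK. Qed.

Section bridge_gh.
Context (R : realType) (d : nat) (Omega : Type).
Context (X : nat -> Omega -> euclid R d) (w : Omega) (n : nat).
Hypothesis n_gt0 : (0 < n)%N.

Let N0 : 0 < n%:R :> R. Proof. by rewrite ltr0n. Qed.

Let grid_subproof (i : 'I_n.+1) : (i%:R / n%:R : R) \in `[0, 1]%classic.
Proof.
apply/mem_set; rewrite /= in_itv/= divr_ge0//= ler_pdivrMr// mul1r ler_nat.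
by rewrite -ltnS.
Qed.

Let grid (i : 'I_n.+1) : unit_interval R :=
  exist (fun x => x \in `[0, 1]%classic) _ (grid_subproof i).

Let near_grid (s : unit_interval R) (i : 'I_n.+1) :
  `|val s - i%:R / n%:R| <= n%:R^-1 ->
  limit_pseudo_dist R s (grid i) <= Num.sqrt n%:R^-1.
Proof.
move=> H; apply: ler_wsqrtr; rewrite [val (grid i)]/= distrC.
apply: le_trans H; rewrite ler_piMl// lerBlDr lerDl//.
Qed.

Lemma bridge_gh_le (e : R) : 0 < e ->
  (forall i j, (i <= j <= n)%N -> `|bridge_dist X n i j w -
     Num.sqrt ((1 - `|j%:R / n%:R - i%:R / n%:R|) * `|j%:R / n%:R - i%:R / n%:R|)|
     <= e) ->
  (gromov_hausdorff_dist (bridge_space X n w) (limit_space R) <=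
   (e + Num.sqrt n%:R^-1)%:E)%E.
Proof.
move=> e0 H.
have H' (i j : 'I_n.+1) : `|bridge_dist X n i j w -
    limit_pseudo_dist R (grid i) (grid j)| <= e.
  wlog ij : i j / (i <= j)%N.
    move=> H1; have [/H1//|/ltnW/H1] := leqP i j.
    by rewrite (pdist_sym _ (grid j)) bridge_dist_sym.
  by apply: H; rewrite ij -ltnS ltn_ord.
apply: (@gh_le_of_corr _ _ _ _ _ (@bridge_point _ _ _ X n w)
  (fun s => \pi_(limit_space R) s)%qT
  (fun i s => `|val s - i%:R / n%:R| <= n%:R^-1)).
- exact: bridge_point_surj.
- exact: limit_point_surj.
- by move=> i; exists (grid i); rewrite /= subrr normr0 invr_ge0 ltW.
- move=> s; have : 0 <= val s <= 1 by have := set_valP s; rewrite /= in_itv.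
  move=> /andP[s0 s1].
  have /truncn_itv/andP[k1 k2] : 0 <= val s * n%:R by rewrite mulr_ge0// ltW.
  set k := Num.truncn _ in k1 k2.
  have kn : (k < n.+1)%N.
    rewrite ltnS -(ler_nat R); apply: le_trans k1 _.
    by rewrite -[leRHS]mul1r ler_wpM2r// ltW.
  exists (Ordinal kn) => /=; rewrite ger0_norm; last first.
    by rewrite subr_ge0 ler_pdivrMr.
  have : val s <= (k%:R + 1) / n%:R by rewrite ler_pdivlMr// natr1 ltW.
  by rewrite mulrDl mul1r lerBlDl.
- by rewrite addr_gt0// sqrtr_gt0 invr_gt0.
(* The distortion is at most [e] on the grid plus [Num.sqrt n%:R^-1] for moving each of the two
   points to the grid, which is below twice the claimed radius. *)
- move=> i i' s s' is_ is'_; rewrite mdist_bridge_point mdist_pi.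
  have := near_grid is_; have := near_grid is'_; have := H' i i'.
  have := pdist_triangle (limit_pseudo_dist R) (grid i) s s'.
  have := pdist_triangle (limit_pseudo_dist R) (grid i') (grid i) s'.
  have := pdist_triangle (limit_pseudo_dist R) s (grid i) (grid i').
  have := pdist_triangle (limit_pseudo_dist R) s' s (grid i').
  rewrite (pdist_sym _ (grid i') s') (pdist_sym _ (grid i) s) !ler_norml.
  by move=> ? ? ? ? /andP[? ?] ? ?; apply/andP; split; lra.
Qed.

End bridge_gh.

(** A correspondence that is good for [w] also serves [w']: the two spaces share their indices, and
    its distortion grows by at most [e]. *)
Lemma bridge_gh_lipschitz (R : realType) (d : nat) (Omega : Type)
    (X : nat -> Omega -> euclid R d) (n : nat) (w w' : Omega) (Y : metricType R)
    (r e : R) : 0 < e ->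
  (forall i j : 'I_n.+1, `|bridge_dist X n i j w - bridge_dist X n i j w'| <= e) ->
  (gromov_hausdorff_dist (bridge_space X n w) Y < r%:E)%E -> 0 < r ->
  (gromov_hausdorff_dist (bridge_space X n w') Y <= (r + e)%:E)%E.
Proof.
move=> e0 H /(corr_of_gh_lt (@bridge_point_surj _ _ _ X n w)
  (fun y : Y => ex_intro _ y erefl)) [Rel [Rl Rr Rd]] r0.
apply: (gh_le_of_corr (@bridge_point_surj _ _ _ X n w')
  (fun y : Y => ex_intro _ y erefl) Rl Rr).
  exact: addr_gt0.
move=> i i' j j' ij ij'; have := Rd _ _ _ _ ij ij'; have := H i i'.
rewrite !mdist_bridge_point !ler_norml => /andP[? ?] /andP[? ?].
by apply/andP; split; lra.
Qed.

(** * Measurability *)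

Lemma measurable_ler (R : realType) (dT : measure_display) (T : measurableType dT)
    (f g : T -> R) : measurable_fun setT f -> measurable_fun setT g ->
  measurable [set w | f w <= g w].
Proof.
by move=> mf mg; rewrite -[X in measurable X]setTI; exact: measurable_fun_le.
Qed.

Lemma measurable_ltr (R : realType) (dT : measure_display) (T : measurableType dT)
    (f g : T -> R) : measurable_fun setT f -> measurable_fun setT g ->
  measurable [set w | f w < g w].
Proof.
move=> mf mg; rewrite (_ : mkset _ = ~` [set w | g w <= f w]).
  by apply: measurableC; exact: measurable_ler.
by apply/seteqP; split=> w /=; rewrite ltNge => /negP.
Qed.

Lemma rat_between (R : realType) (x y : R) : x < y -> exists q : rat, x < (ratr q : R) < y.
Proof. by move=> /rat_in_itvoo[q]; rewrite in_itv; exists q. Qed.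

(** Nothing is assumed about the construction of [S] beyond its stability under small changes of
    finitely many measurable functions. It is therefore the preimage of an open set, exhausted here
    by countably many rational boxes. *)
Lemma measurable_lipschitz_level (R : realType) (dT : measure_display)
    (T : measurableType dT) (I : finType) (D : I -> T -> R) (S : set T) :
  (forall i, measurable_fun setT (D i)) ->
  (forall w, S w -> exists2 e : R, 0 < e &
     forall w', (forall i, `|D i w - D i w'| <= e) -> S w') ->
  measurable S.
Proof.
move=> mD H.
pose box (u : {ffun I -> rat} * rat) : set T :=
  [set w | forall i, `|D i w - ratr (u.1 i)| < ratr u.2].
have -> : S = \bigcup_(u in [set u | box u `<=` S]) box u.
  apply/seteqP; split; last by move=> w [u uS /uS].
  move=> w Sw; have [e e0 He] := H _ Sw.
  (* Two points of a box of radius [r] have values within [2 r] of each other, hence the bound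
     [e / 2]. *)
  have [r /andP[r0 re]] : exists r : rat, 0 < (ratr r : R) < e / 2.
    by apply: rat_between; rewrite divr_gt0.
  have /choice[q qP] : forall i, exists q : rat, D i w - ratr r < (ratr q : R) < D i w.
    by move=> i; apply: rat_between; rewrite ltrBlDr ltrDl.
  exists ([ffun i => q i], r) => /=; last first.
    move=> i; rewrite ffunE ltr_norml; have /andP[? ?] := qP i.
    by apply/andP; split; lra.
  move=> w' w'P; apply: He => i; have := w'P i; rewrite /= ffunE.
  have /andP[? ?] := qP i; rewrite ltr_norml ler_norml => /andP[? ?].
  by apply/andP; split; lra.
rewrite bigcup_mkcond; apply: countable_bigcupT_measurable => [|u].
  exact: countableP.
case: ifP => // _.
have -> : box u = \bigcap_(i in [set: I]) [set w | `|D i w - ratr (u.1 i)| < ratr u.2].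
  by apply/seteqP; split=> [w wu i _|w wu i]; exact: wu.
apply: fin_bigcap_measurable => [|i _]; first exact: finite_finset.
have mf : measurable_fun setT (fun w => `|D i w - ratr (u.1 i)|).
  by apply: measurableT_comp => //; exact: measurable_funB.
exact: measurable_ltr.
Qed.

Lemma measurable_coord (R : realType) (d : nat) (k : 'I_d) :
  measurable_fun setT (fun x : euclid R d => x 0 k : R).
Proof.
apply: (measurability _ (RGenOInfty.measurableE R)) => _ [_ [a ->] <-].
rewrite setTI; apply: sub_sigma_algebra => /=.
rewrite openE => x /=; rewrite in_itv/= andbT => ax.
apply/nbhs_ballP; exists (x 0 k - a) => /=; first by rewrite subr_gt0.
move=> y; rewrite ballEmdist/= mdist_euclid in_itv/= andbT => xy.
have := le_lt_trans (coord_le_enorm (x - y) k) xy.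
by rewrite !mxE; move/(le_lt_trans (ler_norm _)); lra.
Qed.

Section measurable_vectors.
Context (R : realType) (d : nat) (dT : measure_display) (T : measurableType dT).
Implicit Types f g : T -> euclid R d.

Definition coord_measurable f := forall k, measurable_fun setT (fun w => f w 0 k : R).

Lemma measurable_enorm f : coord_measurable f -> measurable_fun setT (fun w => enorm (f w)).
Proof.
move=> mf; rewrite (_ : (fun w => _) =
  (@Num.sqrt R) \o (fun w => \sum_(k < d) f w 0 k ^+ 2))//.
apply: measurableT_comp; first by apply: continuous_measurable_fun; exact: sqrt_continuous.
by apply: measurable_sum => k; exact: measurable_funX.
Qed.

Lemma measurable_dotp f g : coord_measurable f -> coord_measurable g ->
  measurable_fun setT (fun w => dotp (f w) (g w)).
Proof.
by move=> mf mg; apply: measurable_sum => k; exact: measurable_funM.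
Qed.

Lemma coord_measurableB f g : coord_measurable f -> coord_measurable g ->
  coord_measurable (fun w => f w - g w).
Proof.
move=> mf mg k; under eq_fun do rewrite !mxE.
exact: measurable_funB.
Qed.

Lemma coord_measurableZ c f : coord_measurable f ->
  coord_measurable (fun w => c *: f w).
Proof.
move=> mf k; under eq_fun do rewrite !mxE.
exact: measurable_funM.
Qed.

Lemma measurable_walk (X : nat -> T -> euclid R d) n :
  (forall i, (i < n)%N -> coord_measurable (X i)) ->
  forall j, (j <= n)%N -> coord_measurable (walk X j).
Proof.
move=> mX j jn k; under eq_fun do rewrite /walk summxE.
by apply: measurable_sum => i; apply: mX; apply: leq_trans jn.
Qed.

Lemma measurable_bridge_dist (X : nat -> T -> euclid R d) n i j :
  (forall i, coord_measurable (X i)) -> measurable_fun setT (bridge_dist X n i j).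
Proof.
move=> mX; have mw k : coord_measurable (walk X k).
  exact: (@measurable_walk _ k).
apply: measurable_funM => //; apply: measurable_enorm.
by apply: coord_measurableB; apply: coord_measurableB => //; exact: coord_measurableZ.
Qed.

(* The Gromov-Hausdorff distance is a Lipschitz function of the finite matrix of
   mutual distances, so that its superlevel sets are countable unions of boxes. *)
Lemma measurable_gh_gt (X : nat -> T -> euclid R d) (Y : metricType R) n (e : R) :
  0 < e -> (forall i, coord_measurable (X i)) ->
  measurable [set w | (e%:E < gromov_hausdorff_dist (bridge_space X n w) Y)%E].
Proof.
move=> e0 mX; apply: (@measurable_lipschitz_level _ _ _ _
  (fun (ij : 'I_n.+1 * 'I_n.+1) => bridge_dist X n ij.1 ij.2)).
  by move=> ij; exact: measurable_bridge_dist.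
move=> w /= ew.
(* The slack [2 * a] absorbs two losses: [a] turns a distance at most [e] at [w'] into a strict
   bound, and [a / 2] pays for the transfer to [w]. *)
have [a a0 ea] : exists2 a : R, 0 < a &
    ((e + 2 * a)%:E < gromov_hausdorff_dist (bridge_space X n w) Y)%E.
  case: (gromov_hausdorff_dist _ _) ew => [g| |]//=.
    rewrite lte_fin => eg; exists ((g - e) / 4); first by rewrite divr_gt0// subr_gt0.
    by rewrite lte_fin; lra.
  by exists 1 => //; rewrite ltry.
exists (a / 2) => [|w' H]; first by rewrite divr_gt0.
rewrite ltNge; apply/negP => e'.
have : (gromov_hausdorff_dist (bridge_space X n w) Y <= (e + a + a / 2)%:E)%E.
  apply: (@bridge_gh_lipschitz _ _ _ X n w') => [|i j||]; rewrite ?divr_gt0 ?addr_gt0//.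
    by rewrite distrC; exact: (H (i, j)).
  by apply: le_lt_trans e' _; rewrite lte_fin ltrDl.
by apply/negP; rewrite -ltNge; apply: lt_trans ea; rewrite lte_fin; lra.
Qed.

End measurable_vectors.

(** * Expectation of products of independent variables *)

Section independent_expectation.
Context (R : realType) (dO : measure_display) (Omega : measurableType dO).
Context (P : probability Omega R).
Implicit Types f g : Omega -> R.

Definition integrable_rv f := P.-integrable setT (EFin \o f).

Definition independent_rv f g := forall A B : set R, measurable A -> measurable B ->
  P (f @^-1` A `&` g @^-1` B) = (P (f @^-1` A) * P (g @^-1` B))%E.

Let mfun_of f (mf : measurable_fun setT f) : {mfun Omega >-> R} :=
  HB.pack f (isMeasurableFun.Build _ _ _ _ f mf).

Section joint.
Context f g (mf : measurable_fun setT f) (mg : measurable_fun setT g).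
Hypothesis fg : independent_rv f g.

Let F := mfun_of mf.
Let G := mfun_of mg.
Let mH : measurable_fun setT (fun w => (f w, g w)) := measurable_fun_pair mf mg.
Let H : {mfun Omega >-> (R * R)%type} :=
  HB.pack (fun w => (f w, g w)) (isMeasurableFun.Build _ _ _ _ _ mH).
Let mu := distribution P F.
Let nu := distribution P G.

(** Independence says that the law of the pair agrees with the product measure on rectangles, hence
    everywhere. The product formula is then Fubini for [z.1 * z.2]. *)
Let integral_joint (h : R * R -> \bar R) :
  (\int[mu \x nu]_z h z = \int[distribution P H]_z h z)%E.
Proof.
apply: eq_measure_integral => A mA _.
by apply: (product_measure_unique (m' := distribution P H)) => // B C mB mC; exact: fg.
Qed.

Let mmul : measurable_fun setT (fun z : R * R => z.1 * z.2).
Proof. by apply: measurable_funM; [exact: measurable_fst|exact: measurable_snd]. Qed.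

Hypotheses (if_ : integrable_rv f) (ig : integrable_rv g).

Let absE (h : R -> R) (mh : measurable_fun setT h) (Z : {mfun Omega >-> R}) :
  (\int[distribution P Z]_y `|h y|%:E = \int[P]_w `|h (Z w)|%:E)%E.
Proof.
rewrite ge0_integral_distribution//.
by apply: measurableT_comp => //; exact: measurableT_comp.
Qed.

Lemma joint_integrable :
  (mu \x nu)%E.-integrable setT (fun z : R * R => (z.1 * z.2)%:E).
Proof.
apply/integrableP; split; first exact/measurable_EFinP.
rewrite fubini_tonelli1//; last first.
  by apply: measurableT_comp => //; exact/measurable_EFinP.
rewrite /fubini_F/=.
have inner x : (\int[nu]_y `|x * y|%:E = `|x|%:E * \int[P]_w `|g w|%:E)%E.
  under eq_integral => y _ do rewrite normrM EFinM.
  rewrite ge0_integralZl//; last by apply: measurableT_comp => //; exact: measurableT_comp.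
  by rewrite (absE (h := id)).
under eq_integral => x _ do rewrite inner.
rewrite ge0_integralZr//; [|by apply: measurableT_comp => //; exact: measurableT_comp
  |by apply: integral_ge0].
rewrite (absE (h := id))//.
move: if_ ig => /integrableP[_ ifoo] /integrableP[_ igoo].
by rewrite lte_mul_pinfty ?integral_ge0// ge0_fin_numE// integral_ge0.
Qed.

Lemma indep_integrable : integrable_rv (fun w => f w * g w).
Proof.
apply/integrableP; split; first by apply/measurable_EFinP; exact: measurable_funM.
have /integrableP[_] := joint_integrable; rewrite integral_joint.
rewrite ge0_integral_distribution//.
by apply: measurableT_comp => //; exact/measurable_EFinP.
Qed.

Lemma indep_expectation :
  \int[P]_w (f w * g w) = (\int[P]_w f w) * (\int[P]_w g w).
Proof.
rewrite /Rintegral.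
have -> : (\int[P]_w (f w * g w)%:E = \int[mu \x nu]_z (z.1 * z.2)%:E)%E.
  rewrite integral_joint integral_distribution//; first exact/measurable_EFinP.
  exact: indep_integrable.
rewrite -(integral12_prod_meas1 joint_integrable) /fubini_F/=.
have iG : nu.-integrable setT (EFin : R -> \bar R).
  by apply/integrableP; split => //; rewrite (absE (h := id))//; case/integrableP: ig.
have iF : mu.-integrable setT (EFin : R -> \bar R).
  by apply/integrableP; split => //; rewrite (absE (h := id))//; case/integrableP: if_.
have EG : (\int[nu]_y y%:E = \int[P]_w (g w)%:E)%E by rewrite integral_distribution.
have EF : (\int[mu]_y y%:E = \int[P]_w (f w)%:E)%E by rewrite integral_distribution.
have inner x : (\int[nu]_y (x * y)%:E = x%:E * \int[P]_w (g w)%:E)%E.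
  by under eq_integral => y _ do rewrite EFinM; rewrite integralZl// EG.
under eq_integral => x _ do rewrite inner.
have Eg_fin : (\int[P]_w (g w)%:E \is a fin_num)%E by exact: integrable_fin_num.
by rewrite -(fineK Eg_fin) integralZr// EF fineM// integrable_fin_num.
Qed.

End joint.
End independent_expectation.

(** * Independence from the past *)

Section past.
Context (R : realType) (dO : measure_display) (Omega : measurableType dO).
Context (P : probability Omega R) (dT : measure_display) (T : measurableType dT).
Context (X : nat -> {RV P >-> T}).

(** These cylinders form a pi-system, ready for a Dynkin argument, and generate the sigma-algebra of
    [X 0, ..., X (j - 1)]. The type [past j] has the same points as [Omega], so being determined by
    the past is ordinary [measurable_fun] with source [past j]. *)
Definition past_cylinder (j : nat) : set (set Omega) :=
  [set E | exists2 A : nat -> set T, forall i, measurable (A i) &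
    E = \bigcap_(i in `I_j) (X i @^-1` A i)].

Definition past (j : nat) := g_sigma_algebraType (past_cylinder j).

Lemma past_RV i j : (i < j)%N -> measurable_fun (setT : set (past j)) (X i).
Proof.
move=> ij _ C mC; rewrite setTI; apply: sub_sigma_algebra.
exists (fun k => if k == i then C else setT) => [k|]; first by case: ifP.
apply/seteqP; split=> [w Cw k _|w /(_ i ij)]; last by rewrite eqxx.
by case: eqP => // ->.
Qed.

Lemma past_measurable j (E : set (past j)) : measurable E -> measurable (E : set Omega).
Proof.
apply: smallest_sub; first exact: sigma_algebra_measurable.
move=> _ [A mA ->]; apply: fin_bigcap_measurable => // i _.
by rewrite -[X in measurable X]setTI; exact: measurable_funP.
Qed.

Lemma past_measurable_fun d' (T' : measurableType d') j (f : Omega -> T') :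
  measurable_fun (setT : set (past j)) f -> measurable_fun setT f.
Proof. by move=> mf _ B mB; apply: (@past_measurable j); exact: mf. Qed.

Hypothesis X_indep : mutually_independent X.

Lemma past_cylinder_indep j (A : nat -> set T) (B : set T) :
  (forall i, measurable (A i)) -> measurable B ->
  (P ((\bigcap_(i in `I_j) (X i @^-1` A i)) `&` X j @^-1` B) =
   P (\bigcap_(i in `I_j) (X i @^-1` A i)) * P (X j @^-1` B))%E.
Proof.
move=> mA mB; pose A' i := if i == j then B else A i.
have mA' i : measurable (A' i) by rewrite /A'; case: ifP.
have A'j : A' j = B by rewrite /A' eqxx.
have A'i i : (i < j)%N -> A' i = A i by rewrite /A'; case: ltngtP.
pose J : {fset nat} := [fset i | i in iota 0 j]%fset.
have JP i : (i \in J) = (i < j)%N.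
  by apply/imfsetP/idP => [[k /= + ->]|ij]; [|exists i => //=]; rewrite mem_iota.
have jJ : j \notin J by rewrite JP ltnn.
have := X_indep J mA'; have := X_indep (j |` J)%fset mA'.
rewrite big_fsetU1//= A'j => + EJ; rewrite -EJ => EJj.
have JE : \bigcap_(i in [set` J]) X i @^-1` A' i = \bigcap_(i in `I_j) X i @^-1` A i.
  apply/seteqP; split=> w Hw i /= ij; first by rewrite -A'i//; apply: Hw; rewrite /= JP.
  by move: (ij); rewrite JP => ij'; rewrite A'i//; exact: Hw.
rewrite muleC -JE -EJj; congr (P _); apply/seteqP; split=> w.
  move=> [Hw wB] i /=; rewrite in_fset1U => /predU1P[->|]; first by rewrite A'j.
  by move=> iJ; apply: Hw.
move=> Hw; split=> [i /= iJ|]; first by apply: Hw; rewrite /= in_fset1U iJ orbT.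
by have := Hw j; rewrite A'j; apply; rewrite /= in_fset1U eqxx.
Qed.

Lemma past_indep j (E : set (past j)) (B : set T) :
  measurable E -> measurable B ->
  (P (E `&` X j @^-1` B) = P E * P (X j @^-1` B))%E.
Proof.
move=> mE mB; have mXB : measurable (X j @^-1` B).
  by rewrite -[X in measurable X]setTI; exact: measurable_funP.
have PB : P (X j @^-1` B) \is a fin_num by exact: fin_num_measure.
move: E mE; apply: (@dynkin_induction _ (past j) (past_cylinder j)
  (fun E => (P (E `&` X j @^-1` B) = P E * P (X j @^-1` B))%E)) => //.
- move=> _ _ [A mA ->] [C mC ->]; exists (fun i => A i `&` C i).
    by move=> i; exact: measurableI.
  by rewrite -bigcapI.
- by rewrite setTI probability_setT mul1e.
- by move=> _ [A mA ->]; exact: past_cylinder_indep.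
- move=> E /past_measurable mE EP.
  have PE : P E \is a fin_num by exact: fin_num_measure.
  rewrite probability_setC// setIC -setDE.
  have PD : P (X j @^-1` B `\` E) \is a fin_num.
    by apply: fin_num_measure; exact: measurableD.
  have : (P (X j @^-1` B) = P (X j @^-1` B `\` E) + P (E `&` X j @^-1` B))%E.
    by rewrite setIC; exact: measureDI.
  rewrite EP.
  rewrite -(fineK PB) -(fineK PE) -(fineK PD) -EFinB -!EFinM -EFinD => -[e].
  by congr EFin; rewrite mulrBl mul1r {1}e addrK.
- move=> F mF tF FP; have mF' n : measurable (F n : set Omega) by exact: past_measurable.
  rewrite setI_bigcupl measure_semi_bigcup//; last 3 first.
  - by move=> i; exact: measurableI.
  - exact: trivIset_setIr.
  - by apply: bigcup_measurable => i _; exact: measurableI.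
  rewrite (@measure_semi_bigcup _ _ _ P F)//; last exact: bigcup_measurable.
  rewrite muleC -(fineK PB) -nneseriesZl//; apply: eq_eseriesr => i _.
  by rewrite (fineK PB) muleC; exact: FP.
Qed.

Lemma past_independent_rv j (f : Omega -> R) (h : T -> R) :
  measurable_fun (setT : set (past j)) f -> measurable_fun setT h ->
  independent_rv P f (h \o X j).
Proof.
move=> mf mh A B mA mB; have := @past_indep j (f @^-1` A) (h @^-1` B).
apply; first by rewrite -[X in measurable X]setTI; exact: mf.
by rewrite -[X in measurable X]setTI; exact: mh.
Qed.

End past.

(** * Square-integrable random variables *)

Section square_integrable.
Context (R : realType) (dO : measure_display) (Omega : measurableType dO).
Context (P : probability Omega R).
Implicit Types f g : Omega -> R.

Lemma integrable_rv_measurable f : integrable_rv P f -> measurable_fun setT f.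
Proof. by case/integrableP => /measurable_EFinP. Qed.

Lemma integrable_rv_le f g : measurable_fun setT f -> integrable_rv P g ->
  (forall w, `|f w| <= g w) -> integrable_rv P f.
Proof.
move=> mf ig fg; apply: (le_integrable measurableT) ig; first exact/measurable_EFinP.
by move=> w _ /=; rewrite lee_fin (le_trans (fg w))// ler_norm.
Qed.

Lemma integrable_rv_cst c : integrable_rv P (fun=> c).
Proof. exact: finite_measure_integrable_cst. Qed.

Lemma integrable_rvD f g : integrable_rv P f -> integrable_rv P g ->
  integrable_rv P (fun w => f w + g w).
Proof. by move=> /(integrableD measurableT) H /H. Qed.

Lemma integrable_rvZ c f : integrable_rv P f -> integrable_rv P (fun w => c * f w).
Proof. by move=> /(integrableZl measurableT c). Qed.

Lemma integrable_rv_sum (I : Type) (s : seq I) (f : I -> Omega -> R) :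
  (forall i, integrable_rv P (f i)) -> integrable_rv P (fun w => \sum_(i <- s) f i w).
Proof.
move=> H; elim: s => [|i s IH].
  by under eq_fun do rewrite big_nil; exact: integrable_rv_cst.
by under eq_fun do rewrite big_cons; exact: integrable_rvD.
Qed.

Lemma expectation_rvD f g : integrable_rv P f -> integrable_rv P g ->
  \int[P]_w (f w + g w) = \int[P]_w f w + \int[P]_w g w.
Proof. by move=> *; rewrite RintegralD. Qed.

Lemma expectation_rvZ c f : integrable_rv P f ->
  \int[P]_w (c * f w) = c * \int[P]_w f w.
Proof. by move=> *; rewrite RintegralZl. Qed.

Lemma expectation_rv_cst c : \int[P]_w c = c.
Proof.
rewrite Rintegral_cst// [X in fine X](_ : _ = 1%E) ?mulr1//.
exact: probability_setT.
Qed.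

Lemma expectation_rv_sum (I : Type) (s : seq I) (f : I -> Omega -> R) :
  (forall i, integrable_rv P (f i)) ->
  \int[P]_w (\sum_(i <- s) f i w) = \sum_(i <- s) \int[P]_w f i w.
Proof.
move=> H; elim: s => [|i s IH].
  by under eq_Rintegral do rewrite big_nil; rewrite expectation_rv_cst big_nil.
under eq_Rintegral do rewrite big_cons.
by rewrite big_cons expectation_rvD ?IH//; exact: integrable_rv_sum.
Qed.

Lemma expectation_rv_le f g : integrable_rv P f -> integrable_rv P g ->
  (forall w, f w <= g w) -> \int[P]_w f w <= \int[P]_w g w.
Proof. by move=> *; apply: le_Rintegral. Qed.

Definition square_integrable f :=
  measurable_fun setT f /\ integrable_rv P (fun w => f w ^+ 2).

Lemma square_integrable_mul f g : square_integrable f -> square_integrable g ->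
  integrable_rv P (fun w => f w * g w).
Proof.
move=> [mf f2] [mg g2]; apply: integrable_rv_le (integrable_rvD f2 g2) _.
  exact: measurable_funM.
move=> w; rewrite ler_norml.
have := sqr_ge0 (f w - g w); have := sqr_ge0 (f w + g w).
have := sqr_ge0 (f w); have := sqr_ge0 (g w).
by move=> *; apply/andP; split; nra.
Qed.

Lemma square_integrable_le f g : measurable_fun setT f -> square_integrable g ->
  (forall w, `|f w| <= `|g w|) -> square_integrable f.
Proof.
move=> mf [mg g2] fg; split => //; apply: integrable_rv_le g2 _.
  exact: measurable_funX.
move=> w; rewrite ger0_norm ?sqr_ge0// -(real_normK (num_real (f w))).
by rewrite -(real_normK (num_real (g w))) ler_sqr ?nnegrE.
Qed.

Lemma square_integrable_cst c : square_integrable (fun=> c).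
Proof. by split => //; exact: integrable_rv_cst. Qed.

Lemma square_integrable_integrable f : square_integrable f -> integrable_rv P f.
Proof.
move=> f2; have := square_integrable_mul f2 (square_integrable_cst 1).
by under eq_fun do rewrite mulr1.
Qed.

Lemma square_integrableD f g : square_integrable f -> square_integrable g ->
  square_integrable (fun w => f w + g w).
Proof.
move=> f2 g2; split; first by apply: measurable_funD; [case: f2|case: g2].
rewrite (_ : (fun w => _) = fun w => f w ^+ 2 + (2 * (f w * g w) + g w ^+ 2)).
  apply: integrable_rvD; first by case: f2.
  apply: integrable_rvD; last by case: g2.
  by apply: integrable_rvZ; exact: square_integrable_mul.
by apply/funext => w; ring.
Qed.

Lemma square_integrable_sum (I : Type) (s : seq I) (f : I -> Omega -> R) :
  (forall i, square_integrable (f i)) ->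
  square_integrable (fun w => \sum_(i <- s) f i w).
Proof.
move=> H; elim: s => [|i s IH].
  by under eq_fun do rewrite big_nil; exact: square_integrable_cst.
by under eq_fun do rewrite big_cons; exact: square_integrableD.
Qed.

Lemma markov_rv f c : 0 < c -> integrable_rv P f -> (forall w, 0 <= f w) ->
  (P [set w | (c < f w)%R] <= (\int[P]_w f w / c)%:E)%E.
Proof.
move=> c0 if_ f0; have mf := integrable_rv_measurable if_.
have mA : measurable [set w | c < f w] by exact: measurable_ltr.
have PA : P [set w | c < f w] \is a fin_num by exact: fin_num_measure.
rewrite -(fineK PA) lee_fin ler_pdivlMr// mulrC.
rewrite -[leLHS](_ : \int[P]_w (c * \1_[set w | c < f w] w) = _); last first.
  rewrite expectation_rvZ; last first.
    apply: integrable_rv_le (integrable_rv_cst 1) _ => [|w]; first exact: measurable_indic.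
    by rewrite indicE; case: (_ \in _); rewrite /= ?normr1 ?normr0.
  by rewrite /Rintegral integral_indic// setIT.
apply: expectation_rv_le => // [|w].
  apply: integrable_rv_le if_ _ => [|w].
    by apply: measurable_funM => //; exact: measurable_indic.
  rewrite indicE; case: (boolP (_ \in _)) => [/set_mem/= cf|_]; rewrite ?mulr0 ?normr0//.
  by rewrite mulr1 gtr0_norm// ltW.
rewrite indicE; case: (boolP (_ \in _)) => [/set_mem/= cf|_]; rewrite ?mulr0//.
by rewrite mulr1 ltW.
Qed.

End square_integrable.

(** * A maximal inequality *)

Section stopped_sum.
Context (R : realDomainType) (c : R) (q : nat -> R).

Definition partial_sum k := \sum_(j < k) q j.

Definition below k := [forall i : 'I_k.+1, `|partial_sum i| <= c].

(** The weight of [q j] depends on [q 0, ..., q (j - 1)] only, so it is known before [q j]. The sum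
    freezes right after the first exit from [[-c, c]], overshoot included, and thus stays beyond [c]
    from then on. *)
Definition stopped_sum k := \sum_(j < k) (below j)%:R * q j.

Lemma belowP k : reflect (forall i, (i <= k)%N -> `|partial_sum i| <= c) (below k).
Proof.
apply: (iffP forallP) => H i; last by apply: H; rewrite -ltnS.
by rewrite -ltnS => ik; exact: (H (Ordinal ik)).
Qed.

Lemma belowS k : below k.+1 = below k && (`|partial_sum k.+1| <= c).
Proof.
apply/belowP/andP => [H|[/belowP H Hk] i].
  by split; [apply/belowP => i ik; apply: H; exact: leqW|exact: H].
by rewrite leq_eqVlt => /predU1P[->//|]; rewrite ltnS; exact: H.
Qed.

Lemma stopped_sumE k : 0 <= c ->
  if below k then stopped_sum k = partial_sum k else c < `|stopped_sum k|.
Proof.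
move=> c0; elim: k => [|k IH].
  case: ifP => [_|/belowP[] i]; first by rewrite /stopped_sum /partial_sum !big_ord0.
  by rewrite leqn0 => /eqP->; rewrite /partial_sum big_ord0 normr0.
have SE : stopped_sum k.+1 = stopped_sum k + (below k)%:R * q k.
  by rewrite /stopped_sum big_ord_recr.
have QE : partial_sum k.+1 = partial_sum k + q k by rewrite /partial_sum big_ord_recr.
rewrite SE belowS; case: ifP IH => /= [_ ->|_]; last by rewrite mul0r addr0.
by rewrite mul1r -QE; case: leP.
Qed.

End stopped_sum.

Section maximal_inequality.
Context (R : realType) (dO : measure_display) (Omega : measurableType dO).
Context (P : probability Omega R) (dT : measure_display) (T : measurableType dT).
Context (X : nat -> {RV P >-> T}) (q : nat -> Omega -> R).
Hypothesis q_past : forall i j, (i < j)%N ->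
  measurable_fun (setT : set (past X j)) (q i).
Hypothesis q_L2 : forall j, square_integrable P (q j).
(** The martingale difference property, tested against square-integrable functions of the past
    instead of being stated through a conditional expectation. *)
Hypothesis q_orth : forall j f, measurable_fun (setT : set (past X j)) f ->
  square_integrable P f -> \int[P]_w (q j w * f w) = 0.
Context (c : R).

Lemma measurable_partial_sum i j : (i <= j)%N ->
  measurable_fun (setT : set (past X j)) (fun w => partial_sum (q^~ w) i).
Proof.
move=> ij; apply: measurable_sum => k; apply: q_past.
exact: leq_trans ij.
Qed.

Lemma measurable_below i j : (i <= j)%N ->
  measurable ([set w | below c (q^~ w) i] : set (past X j)).
Proof.
move=> ij; rewrite (_ : mkset _ = \bigcap_(k in `I_i.+1)
    [set w | `|partial_sum (q^~ w) k| <= c]); last first.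
  apply/seteqP; split=> w /= => [/belowP H k /= ki|H]; first by apply: H; rewrite -ltnS.
  by apply/belowP => k ki; apply: H; rewrite /= ltnS.
apply: fin_bigcap_measurable => // k /= ki; apply: measurable_ler => //.
apply: measurableT_comp => //; apply: measurable_partial_sum.
by apply: leq_trans ij; rewrite -ltnS.
Qed.

Lemma measurable_not_below i : measurable [set w | ~~ below c (q^~ w) i].
Proof.
rewrite (_ : mkset _ = ~` [set w | below c (q^~ w) i]).
  by apply: measurableC; apply: (@past_measurable _ _ _ _ _ _ X i); exact: measurable_below.
by apply/seteqP; split=> w /= /negP.
Qed.

Let indE i w : (below c (q^~ w) i)%:R = \1_[set w | below c (q^~ w) i] w :> R.
Proof.
rewrite indicE; case: (boolP (below _ _ _)) => H; first by rewrite mem_set.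
by rewrite memNset//; exact/negP.
Qed.

Let measurable_ind i j : (i <= j)%N ->
  measurable_fun (setT : set (past X j)) (fun w => (below c (q^~ w) i)%:R : R).
Proof.
move=> ij; under eq_fun do rewrite indE.
by apply: measurable_indic; exact: measurable_below.
Qed.

Let g i w : R := (below c (q^~ w) i)%:R * q i w.

Let g_L2 i : square_integrable P (g i).
Proof.
apply: square_integrable_le (q_L2 i) _ => [|w].
  apply: measurable_funM; last by case: (q_L2 i).
  by apply: (@past_measurable_fun _ _ _ _ _ _ X _ _ i); exact: measurable_ind.
by rewrite /g; case: below; rewrite ?mul1r// mul0r normr0.
Qed.

Let Z_past i j : (i <= j)%N ->
  measurable_fun (setT : set (past X j)) (fun w => stopped_sum c (q^~ w) i).
Proof.
move=> ij; apply: measurable_sum => k; have kj := leq_trans (ltn_ord k) ij.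
by apply: measurable_funM; [apply: measurable_ind; exact: ltnW|exact: q_past].
Qed.

Let Z_L2 i : square_integrable P (fun w => stopped_sum c (q^~ w) i).
Proof. by apply: square_integrable_sum => k; exact: g_L2. Qed.

Let Z_moment k : \int[P]_w (stopped_sum c (q^~ w) k ^+ 2) <=
  \sum_(j < k) \int[P]_w (q j w ^+ 2).
Proof.
elim: k => [|k IH].
  under eq_Rintegral do rewrite /stopped_sum big_ord0 expr0n/=.
  by rewrite expectation_rv_cst big_ord0.
rewrite big_ord_recr/=.
under eq_Rintegral => w _.
  rewrite /stopped_sum big_ord_recr/= -/(stopped_sum c (q^~ w) k).
  rewrite (_ : _ ^+ 2 = stopped_sum c (q^~ w) k ^+ 2 +
    (2 * (q k w * ((below c (q^~ w) k)%:R * stopped_sum c (q^~ w) k)) + g k w ^+ 2)); last first.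
    by rewrite /g; ring.
  over.
(* The cross term of the square is [q k] times this function of the past, so [q_orth] removes it; in
   the last term dropping the indicator only increases the integral. *)
pose f w := (below c (q^~ w) k)%:R * stopped_sum c (q^~ w) k.
have mf : measurable_fun (setT : set (past X k)) f.
  by apply: measurable_funM; [exact: measurable_ind|exact: Z_past].
have f_L2 : square_integrable P f.
  apply: square_integrable_le (Z_L2 k) _ => [|w].
    exact: (@past_measurable_fun _ _ _ _ _ _ X _ _ k).
  by rewrite /f; case: below; rewrite ?mul1r// mul0r normr0.
have iqf := square_integrable_mul (q_L2 k) f_L2.
rewrite expectation_rvD; [|by case: (Z_L2 k)|]; last first.
  by apply: integrable_rvD; [exact: integrable_rvZ|case: (g_L2 k)].
rewrite expectation_rvD; [|exact: integrable_rvZ|by case: (g_L2 k)].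
rewrite expectation_rvZ// q_orth// mulr0 add0r lerD//.
apply: expectation_rv_le; [by case: (g_L2 k)|by case: (q_L2 k)|].
by move=> w; rewrite /g; case: below; rewrite ?mul1r// mul0r expr0n sqr_ge0.
Qed.

(* Kolmogorov's inequality, read off the sum stopped when it first exceeds c. *)
Lemma maximal_inequality N : 0 < c ->
  (P [set w | ~~ below c (q^~ w) N] <=
   ((\sum_(j < N) \int[P]_w (q j w ^+ 2)) / c ^+ 2)%:E)%E.
Proof.
move=> c0; have c20 : 0 < c ^+ 2 by rewrite exprn_gt0.
have iZ : integrable_rv P (fun w => stopped_sum c (q^~ w) N ^+ 2) by case: (Z_L2 N).
apply: (@le_trans _ _ (P [set w | c ^+ 2 < stopped_sum c (q^~ w) N ^+ 2])).
  apply: le_measure; rewrite ?inE.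
  - exact: measurable_not_below.
  - by apply: measurable_ltr => //; exact: integrable_rv_measurable iZ.
  - move=> w /= /negPf bw; have := stopped_sumE (q^~ w) N (ltW c0); rewrite bw => H.
    by rewrite -(real_normK (num_real (stopped_sum _ _ _))) ltr_pXn2r// nnegrE// ltW.
apply: le_trans (markov_rv c20 iZ _) _ => [w|]; first exact: sqr_ge0.
by rewrite lee_fin ler_pM2r ?invr_gt0.
Qed.

End maximal_inequality.

(** * Cross terms of the squared increments *)

Section identically_distributed.
Context (R : realType) (dO : measure_display) (Omega : measurableType dO).
Context (P : probability Omega R) (dT : measure_display) (T : measurableType dT).
Context (X : nat -> {RV P >-> T}).
Hypothesis X_iid : iid X.

Let integral_iid i (h : T -> \bar R) :
  (\int[distribution P (X i)]_x h x = \int[distribution P (X 0%N)]_x h x)%E.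
Proof. by apply: eq_measure_integral => A mA _; exact: X_iid.2. Qed.

Lemma iid_integrable i (h : T -> R) : measurable_fun setT h ->
  integrable_rv P (fun w => h (X 0%N w)) -> integrable_rv P (fun w => h (X i w)).
Proof.
move=> mh /integrableP[_ ih]; apply/integrableP; split.
  by apply/measurable_EFinP; exact: measurableT_comp.
apply: le_lt_trans ih.
rewrite -[leLHS](@ge0_integral_distribution _ _ _ _ _ P (X i)
  (fun x => `|(h x)%:E|%E))//; last first.
  by apply: measurableT_comp => //; exact/measurable_EFinP.
rewrite -[leRHS](@ge0_integral_distribution _ _ _ _ _ P (X 0%N)
  (fun x => `|(h x)%:E|%E))//; last first.
  by apply: measurableT_comp => //; exact/measurable_EFinP.
by rewrite integral_iid.
Qed.

Lemma iid_expectation i (h : T -> R) : measurable_fun setT h ->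
  integrable_rv P (fun w => h (X 0%N w)) ->
  \int[P]_w h (X i w) = \int[P]_w h (X 0%N w).
Proof.
move=> mh ih; rewrite /Rintegral.
rewrite -(@integral_distribution _ _ _ _ _ P (X i) (EFin \o h))//; last first.
- exact: iid_integrable.
- exact/measurable_EFinP.
rewrite -(@integral_distribution _ _ _ _ _ P (X 0%N) (EFin \o h))//; last first.
  exact/measurable_EFinP.
by rewrite integral_iid.
Qed.

(** Replaces conditioning on the past: [X j] is independent of it and has the law of [X 0]. The
    moment computations for the cross terms and the truncated norms rest on this. *)
Lemma past_expectation j (f : Omega -> R) (h : T -> R) :
  measurable_fun (setT : set (past X j)) f -> measurable_fun setT h ->
  integrable_rv P f -> integrable_rv P (fun w => h (X 0%N w)) ->
  integrable_rv P (fun w => f w * h (X j w)) /\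
  \int[P]_w (f w * h (X j w)) = \int[P]_w f w * \int[P]_w h (X 0%N w).
Proof.
move=> pf mh if_ ih; have mf := past_measurable_fun pf.
have mhX : measurable_fun setT (h \o X j) by exact: measurableT_comp.
have ij := iid_integrable j mh ih.
have ind : independent_rv P f (h \o X j) by apply: past_independent_rv => //; exact: X_iid.1.
split; first exact: (indep_integrable mf mhX ind).
by rewrite -(iid_expectation j mh ih); exact: (indep_expectation mf mhX ind).
Qed.

End identically_distributed.

Lemma enorm0 (R : realType) (d : nat) : enorm (0 : euclid R d) = 0.
Proof. by rewrite -(scale0r 0) enormZ normr0 mul0r. Qed.

Section quadratic_increments.
Context (R : realType) (d : nat) (dO : measure_display) (Omega : measurableType dO).
Context (P : probability Omega R) (X : nat -> {RV P >-> euclid R d}) (s : R).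
Hypothesis X_iid : iid X.
Hypothesis X_centered : forall k, \int[P]_w X 0%N w 0 k = 0.
Hypothesis X_integrable : integrable_rv P (fun w => enorm (X 0%N w) ^+ 2).
Hypothesis X_normalized : \int[P]_w enorm (X 0%N w) ^+ 2 = 1.
Hypothesis X_uncorrelated : forall j k, j != k ->
  \int[P]_w (X 0%N w 0 j * X 0%N w 0 k) = 0.
Hypothesis X_small : forall k, \int[P]_w (X 0%N w 0 k ^+ 2) <= s.

Let mcoord k : measurable_fun setT (fun x : euclid R d => x 0 k : R) :=
  @measurable_coord R d k.

Let past_coord i j k : (i < j)%N ->
  measurable_fun (setT : set (past X j)) (fun w => X i w 0 k).
Proof.
by move=> ij; exact: (measurableT_comp (mcoord k) (@past_RV _ _ _ _ _ _ X _ _ ij)).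
Qed.

Lemma coord_L2 i k : square_integrable P (fun w => X i w 0 k).
Proof.
have m0 j : measurable_fun setT (fun w => X j w 0 k).
  exact: (measurableT_comp (mcoord k) (measurable_funP (X j))).
split => //; apply: (@iid_integrable _ _ _ _ _ _ X X_iid i (fun x => x 0 k ^+ 2)).
  exact: measurable_funX.
apply: integrable_rv_le X_integrable _ => [|w]; first exact: measurable_funX.
rewrite ger0_norm ?sqr_ge0// -(real_normK (num_real (X 0%N w 0 k))).
by rewrite ler_sqr ?nnegrE ?enorm_ge0//; exact: coord_le_enorm.
Qed.

(** The minimum makes the increment vanish for [j <= a], so that sums of cross terms may start at 0
    whatever [a] is. *)
Definition increment (a j : nat) (w : Omega) : euclid R d :=
  walk X j w - walk X (minn a j) w.

Definition cross_term (a j : nat) (w : Omega) : R :=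
  dotp (increment a j w) (X j w).

Lemma incrementS a j w :
  increment a j.+1 w = increment a j w + (if (a <= j)%N then X j w else 0).
Proof.
rewrite /increment; case: leqP => aj.
  by rewrite !(minn_idPl _) ?walkS 1?addrAC//; exact: leqW.
by rewrite !(minn_idPr _) ?subrr ?addr0//; exact: ltnW.
Qed.

Lemma increment_past a i j : (i <= j)%N ->
  coord_measurable (increment a i : past X j -> euclid R d).
Proof.
move=> ij; have mw k : (k <= j)%N -> coord_measurable (walk X k : past X j -> euclid R d).
  apply: measurable_walk => l lj c.
  exact: past_coord.
by apply: coord_measurableB; apply: mw => //; rewrite geq_min ij orbT.
Qed.

Let past_increment a j k :
  measurable_fun (setT : set (past X j)) (fun w => increment a j w 0 k).
Proof. by apply: increment_past. Qed.

Lemma increment_L2 a j k : square_integrable P (fun w => increment a j w 0 k).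
Proof.
elim: j => [|j IH].
  under eq_fun do rewrite /increment minn0 subrr mxE.
  exact: square_integrable_cst.
under eq_fun do rewrite incrementS mxE.
apply: square_integrableD => //; case: (a <= j)%N; first exact: coord_L2.
by under eq_fun do rewrite mxE; exact: square_integrable_cst.
Qed.

Lemma cross_term_past a i j : (i < j)%N ->
  measurable_fun (setT : set (past X j)) (cross_term a i).
Proof.
move=> ij; apply: measurable_dotp; first exact: increment_past (ltnW ij).
by move=> c; exact: past_coord.
Qed.

Lemma cross_term_orth a j f : measurable_fun (setT : set (past X j)) f ->
  square_integrable P f ->
  \int[P]_w (cross_term a j w * f w) = 0.
Proof.
move=> mf f2; under eq_Rintegral.
  move=> w _; rewrite /cross_term /dotp mulr_suml.
  under eq_bigr do rewrite mulrAC.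
  over.
have H k := @past_expectation _ _ _ _ _ _ X X_iid j
  (fun w => increment a j w 0 k * f w) (fun x => x 0 k)
  (measurable_funM (@past_increment a j k) mf) (mcoord k)
  (square_integrable_mul (@increment_L2 a j k) f2)
  (square_integrable_integrable (@coord_L2 0 k)).
rewrite expectation_rv_sum; last by move=> k; case: (H k).
by apply: big1 => k _; case: (H k) => _ ->; rewrite X_centered mulr0.
Qed.

Let sq_cross a j w : cross_term a j w ^+ 2 = \sum_k \sum_l
  (increment a j w 0 k * increment a j w 0 l) * (X j w 0 k * X j w 0 l).
Proof.
rewrite /cross_term /dotp expr2 mulr_suml; apply: eq_bigr => k _.
by rewrite mulr_sumr; apply: eq_bigr => l _; ring.
Qed.

(** The integrand has degree two in [X j], and independence factors this off the product of past
    increments. Second moments therefore suffice to make the squared cross term integrable. *)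
Let sq_cross_term a j k l := @past_expectation _ _ _ _ _ _ X X_iid j
  (fun w => increment a j w 0 k * increment a j w 0 l) (fun x => x 0 k * x 0 l)
  (measurable_funM (@past_increment a j k) (@past_increment a j l))
  (measurable_funM (mcoord k) (mcoord l))
  (square_integrable_mul (@increment_L2 a j k) (@increment_L2 a j l))
  (square_integrable_mul (@coord_L2 0 k) (@coord_L2 0 l)).

Lemma cross_term_L2 a j : square_integrable P (cross_term a j).
Proof.
split; first exact: past_measurable_fun (cross_term_past a (ltnSn j)).
under eq_fun do rewrite sq_cross.
by apply: integrable_rv_sum => k; apply: integrable_rv_sum => l; case: (@sq_cross_term a j k l).
Qed.

Lemma increment_moment a j : \int[P]_w (enorm (increment a j w) ^+ 2) <= j%:R.
Proof.
elim: j => [|j IH].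
  under eq_Rintegral do rewrite /increment minn0 subrr enorm0 expr0n/=.
  by rewrite expectation_rv_cst.
have iI i : integrable_rv P (fun w => enorm (increment a i w) ^+ 2).
  under eq_fun do rewrite sqr_enorm.
  by apply: integrable_rv_sum => k; case: (@increment_L2 a i k).
have [aj|ja] := leqP a j; last first.
  under eq_Rintegral do rewrite incrementS leqNgt ja addr0.
  by rewrite (le_trans IH)// ler_nat.
under eq_Rintegral do rewrite incrementS aj sqr_enormD -addrA.
have mX2 : measurable_fun setT (fun x : euclid R d => enorm x ^+ 2).
  by apply: measurable_funX; exact: measurable_enorm.
have iX : integrable_rv P (fun w => enorm (X j w) ^+ 2).
  exact: (@iid_integrable _ _ _ _ _ _ X X_iid j (fun x => enorm x ^+ 2)).
have iC := square_integrable_integrable (cross_term_L2 a j).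
rewrite expectation_rvD//; last by apply: integrable_rvD => //; exact: integrable_rvZ.
rewrite expectation_rvD//; last exact: integrable_rvZ.
rewrite expectation_rvZ//.
rewrite (@iid_expectation _ _ _ _ _ _ X X_iid j (fun x => enorm x ^+ 2))//.
rewrite X_normalized -[leRHS]natr1.
have := @cross_term_orth a j (fun=> 1) (@measurable_cst _ _ _ _ _ _) (square_integrable_cst _ 1).
under eq_Rintegral do rewrite mulr1.
by rewrite /cross_term => ->; rewrite mulr0 add0r lerD2r.
Qed.

(** Uncorrelatedness kills the pairs of distinct coordinates. On the diagonal each coordinate
    variance is at most [s], and the increment coordinates add up to a squared norm of mean at most
    [j]. *)
Lemma cross_term_moment a j : 0 <= s -> \int[P]_w (cross_term a j w ^+ 2) <= s * j%:R.
Proof.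
move=> s0; under eq_Rintegral do rewrite sq_cross.
rewrite expectation_rv_sum; last first.
  by move=> k; apply: integrable_rv_sum => l; case: (@sq_cross_term a j k l).
have iI k : integrable_rv P (fun w => increment a j w 0 k ^+ 2) by case: (@increment_L2 a j k).
apply: (@le_trans _ _ (\sum_k s * \int[P]_w (increment a j w 0 k ^+ 2))); last first.
  rewrite -mulr_sumr ler_wpM2l// -expectation_rv_sum//.
  by under eq_Rintegral do rewrite -sqr_enorm; exact: increment_moment.
apply: ler_sum => k _; rewrite expectation_rv_sum; last first.
  by move=> l; case: (@sq_cross_term a j k l).
rewrite (bigD1 k)//= big1 ?addr0; last first.
  by move=> l lk; case: (@sq_cross_term a j k l) => _ ->; rewrite X_uncorrelated ?mulr0// eq_sym.
case: (@sq_cross_term a j k k) => _ ->; rewrite mulrC ler_pM//.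
- by apply: Rintegral_ge0 => w _; exact: sqr_ge0.
- by apply: Rintegral_ge0 => w _; exact: sqr_ge0.
- exact: X_small.
Qed.

(** The second moments add up to at most [s N^2] while the level squared is [c^2 N^2]: the bound
    does not depend on [N], and [s] may tend to 0 at any speed. *)
Lemma cross_term_bad a N (c : R) : (0 < N)%N -> 0 <= s -> 0 < c ->
  exists B : set Omega, [/\ measurable B, (P B <= (s / c ^+ 2)%:E)%E &
    forall w, ~ B w -> forall k, (k <= N)%N ->
      `|\sum_(j < k) cross_term a j w| <= c * N%:R].
Proof.
move=> N0 s0 c0; have N0' : 0 < N%:R :> R by rewrite ltr0n.
have cN : 0 < c * N%:R by rewrite mulr_gt0.
exists [set w | ~~ below (c * N%:R) (fun j => cross_term a j w) N]; split.
- exact: (@measurable_not_below _ _ _ _ _ _ X _ (@cross_term_past a)).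
- apply: (le_trans (maximal_inequality (@cross_term_past a) (cross_term_L2 a)
    (@cross_term_orth a) N cN)).
  rewrite lee_fin ler_pdivrMr ?exprn_gt0// exprMn mulrA divfK ?gt_eqF ?exprn_gt0//.
  apply: (@le_trans _ _ (\sum_(j < N) s * N%:R)).
    apply: ler_sum => j _; apply: (le_trans (cross_term_moment a j s0)).
    by rewrite ler_wpM2l// ler_nat ltnW.
  by rewrite sumr_const card_ord expr2 -mulrnAr mulr_natr.
- by move=> w /negP; rewrite negbK => /belowP.
Qed.

End quadratic_increments.

(** * Sums of squared norms *)

Definition tail_sqnorm (R : realType) (d : nat) (A : R) (x : euclid R d) : R :=
  if A < enorm x ^+ 2 then enorm x ^+ 2 else 0.

Section squared_norms.
Context (R : realType) (d : nat) (dO : measure_display) (Omega : measurableType dO).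
Context (P : probability Omega R) (X : nat -> {RV P >-> euclid R d}) (A z : R).
Hypothesis X_iid : iid X.
Hypothesis X_integrable : integrable_rv P (fun w => enorm (X 0%N w) ^+ 2).
Hypothesis X_normalized : \int[P]_w enorm (X 0%N w) ^+ 2 = 1.
Hypothesis A_ge0 : 0 <= A.
Hypothesis X_tail : \int[P]_w tail_sqnorm A (X 0%N w) <= z.

Let over := @tail_sqnorm R d A.

Let trunc (x : euclid R d) : R := enorm x ^+ 2 - over x.

Let mX2 : measurable_fun setT (fun x : euclid R d => enorm x ^+ 2).
Proof.
apply: measurable_funX; apply: (measurable_enorm (f := id)).
exact: measurable_coord.
Qed.

Let mover : measurable_fun setT over.
Proof.
rewrite (_ : over = fun x => enorm x ^+ 2 * \1_[set x | A < enorm x ^+ 2] x).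
  apply: measurable_funM => //; apply: measurable_indic.
  exact: measurable_ltr.
apply/funext => x; rewrite indicE /over /tail_sqnorm.
case: ifP => [H|/negbT H]; first by rewrite mem_set// mulr1.
by rewrite memNset ?mulr0//; exact/negP.
Qed.

Let mtrunc : measurable_fun setT trunc.
Proof. exact: measurable_funB. Qed.

Let over_ge0 x : 0 <= over x.
Proof. by rewrite /over /tail_sqnorm; case: ifP; rewrite ?sqr_ge0. Qed.

Let trunc_itv x : 0 <= trunc x <= A.
Proof.
rewrite /trunc /over /tail_sqnorm; case: ltP => h; rewrite ?subrr ?subr0.
  by rewrite lexx.
by rewrite sqr_ge0.
Qed.

Let itrunc : integrable_rv P (fun w => trunc (X 0%N w)).
Proof.
apply: integrable_rv_le (integrable_rv_cst _ A) _ => [|w].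
  exact: (measurableT_comp mtrunc).
by have /andP[t0 tA] := trunc_itv (X 0%N w); rewrite ger0_norm.
Qed.

Let iover : integrable_rv P (fun w => over (X 0%N w)).
Proof.
apply: integrable_rv_le X_integrable _ => [|w].
  exact: (measurableT_comp mover).
rewrite ger0_norm// -subr_ge0.
by have /andP[] := trunc_itv (X 0%N w).
Qed.

Let b := \int[P]_w trunc (X 0%N w).

Let b_itv : 0 <= b <= A.
Proof.
apply/andP; split; first by apply: Rintegral_ge0 => w _; have /andP[] := trunc_itv (X 0%N w).
rewrite -[leRHS](expectation_rv_cst P A); apply: expectation_rv_le => //.
  exact: integrable_rv_cst.
by move=> w; have /andP[] := trunc_itv (X 0%N w).
Qed.

Let b_near1 : 0 <= 1 - b <= z.
Proof.
have -> : 1 - b = \int[P]_w over (X 0%N w).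
  rewrite -X_normalized -(RintegralB _ X_integrable itrunc)//.
  by apply: eq_Rintegral => w _; rewrite /trunc; ring.
by rewrite X_tail andbT; apply: Rintegral_ge0.
Qed.

Let q (i : nat) (w : Omega) : R := trunc (X i w) - b.

Let mq : measurable_fun setT (fun x => trunc x - b).
Proof. exact: measurable_funB. Qed.

Let q_past i j : (i < j)%N -> measurable_fun (setT : set (past X j)) (q i).
Proof.
move=> ij; exact: (measurableT_comp mq (@past_RV _ _ _ _ _ _ X _ _ ij)).
Qed.

Let q_le i w : `|q i w| <= A.
Proof.
have /andP[t0 tA] := trunc_itv (X i w); have /andP[b0 bA] := b_itv.
by rewrite /q ler_norml; apply/andP; split; lra.
Qed.

Let q_L2 j : square_integrable P (q j).
Proof.
apply: square_integrable_le (square_integrable_cst _ A) _ => [|w].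
  exact: (measurableT_comp mq).
by rewrite (ger0_norm A_ge0).
Qed.

Let q_orth j f : measurable_fun (setT : set (past X j)) f ->
  square_integrable P f -> \int[P]_w (q j w * f w) = 0.
Proof.
move=> mf f2; under eq_Rintegral do rewrite mulrC.
have iq : integrable_rv P (fun w => trunc (X 0%N w) - b).
  exact: square_integrable_integrable (q_L2 0).
have [_ ->] := @past_expectation _ _ _ _ _ _ X X_iid j f (fun x => trunc x - b) mf mq
  (square_integrable_integrable f2) iq.
rewrite RintegralB//; last exact: integrable_rv_cst.
by rewrite expectation_rv_cst subrr mulr0.
Qed.

Lemma sum_norms_bad N (c : R) : (0 < N)%N -> 0 < c -> z <= c ->
  exists B : set Omega, [/\ measurable B, (P B <= (A ^+ 2 / (c ^+ 2 * N%:R) + z / c)%:E)%E &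
    forall w, ~ B w -> forall k, (k <= N)%N ->
      `|\sum_(i < k) enorm (X i w) ^+ 2 - k%:R| <= 3 * c * N%:R].
Proof.
move=> N0 c0 zc; have N0' : 0 < N%:R :> R by rewrite ltr0n.
have cN : 0 < c * N%:R by rewrite mulr_gt0.
pose B1 := [set w | ~~ below (c * N%:R) (q^~ w) N].
pose V w := \sum_(i < N) over (X i w).
have iV : integrable_rv P V.
  apply: integrable_rv_sum => i; exact: (@iid_integrable _ _ _ _ _ _ X X_iid i over).
have EV : \int[P]_w V w <= z * N%:R.
  rewrite expectation_rv_sum; last first.
    by move=> i; exact: (@iid_integrable _ _ _ _ _ _ X X_iid i over).
  rewrite mulr_natr -[X in _ *+ X]card_ord -sumr_const; apply: ler_sum => i _.
  by rewrite (@iid_expectation _ _ _ _ _ _ X X_iid i over).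
pose B2 := [set w | c * N%:R < V w].
have mB1 : measurable B1 by exact: (@measurable_not_below _ _ _ _ _ _ X _ q_past).
have mB2 : measurable B2 by apply: measurable_ltr => //; exact: integrable_rv_measurable iV.
exists (B1 `|` B2); split; first exact: measurableU.
- apply: le_trans (measureU2 _ mB1 mB2) _; rewrite EFinD; apply: leeD.
    apply: (le_trans (maximal_inequality q_past q_L2 q_orth N cN)).
    rewrite lee_fin ler_pdivrMr ?exprn_gt0// (_ : _ / _ * _ = A ^+ 2 * N%:R); last first.
      by field; rewrite !gt_eqF.
    rewrite mulr_natr -[X in _ *+ X]card_ord -sumr_const; apply: ler_sum => i _.
    rewrite -[leRHS](expectation_rv_cst P); apply: expectation_rv_le.
    - by case: (q_L2 i).
    - exact: integrable_rv_cst.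
    - by move=> w; rewrite -(real_normK (num_real (q i w))) ler_sqr ?nnegrE.
  apply: le_trans (markov_rv cN iV _) _ => [w|]; first exact: sumr_ge0.
  rewrite lee_fin ler_pdivrMr// (_ : _ / _ * _ = z * N%:R)//.
  by field; rewrite gt_eqF.
- move=> w /not_orP[/negP]; rewrite negbK => /belowP H1 /negP; rewrite -leNgt => H2 k kN.
  (* Three errors of at most [c * N%:R] each: the centred truncated sum, the part above the
     truncation level, bounded by its value at [N] because it is monotone, and the bias [1 - b] of
     the truncated mean. *)
  have -> : \sum_(i < k) enorm (X i w) ^+ 2 - k%:R =
      partial_sum (q^~ w) k + \sum_(i < k) over (X i w) - k%:R * (1 - b).
    rewrite -[k in k%:R]card_ord -!sumr_const mulr_suml /partial_sum -sumrB -big_split/= -sumrB.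
    by apply: eq_bigr => i _; rewrite /q /trunc; ring.
  have Vk : \sum_(i < k) over (X i w) <= V w.
    rewrite /V -!(big_mkord xpredT (fun i => over (X i w))).
    by rewrite [leRHS](@big_cat_nat _ _ _ k)//= lerDl sumr_ge0.
  have Vk0 : 0 <= \sum_(i < k) over (X i w) by rewrite sumr_ge0.
  have kb : 0 <= k%:R * (1 - b) <= c * N%:R.
    have /andP[b0 b1] := b_near1; rewrite mulr_ge0//= mulrC ler_pM// ?ler_nat//.
    exact: le_trans zc.
  have := H1 _ kN; move: kb => /andP[kb0 kb1]; rewrite !ler_norml => /andP[p0 p1].
  by apply/andP; split; lra.
Qed.

End squared_norms.

(** * Uniform control of the distances *)

Section walk_distances.
Context (R : realType) (d : nat) (dO : measure_display) (Omega : measurableType dO).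
Context (P : probability Omega R) (X : nat -> {RV P >-> euclid R d}).

Lemma sqr_enorm_increment a k w : enorm (increment X a k w) ^+ 2 =
  \sum_(i < k) enorm (X i w) ^+ 2 - \sum_(i < minn a k) enorm (X i w) ^+ 2 +
  2 * \sum_(j < k) cross_term X a j w.
Proof.
elim: k => [|k IH].
  by rewrite /increment minn0 subrr enorm0 !big_ord0; ring.
rewrite incrementS !big_ord_recr/=; have [ak|ka] := leqP a k.
  by rewrite sqr_enormD IH /cross_term !(minn_idPl _)//; [ring|exact: leqW].
have kE : minn a k = k by apply/minn_idPr; exact: ltnW.
have kE' : minn a k.+1 = k.+1 by exact/minn_idPr.
have c0 : cross_term X a k w = 0.
  by rewrite /cross_term /increment kE subrr /dotp big1// => i _; rewrite mxE mul0r.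
by rewrite addr0 IH kE kE' big_ord_recr/= c0; ring.
Qed.

Lemma sqdistE a k w : (a <= k)%N -> sqdist X w a k =
  \sum_(i < k) enorm (X i w) ^+ 2 - \sum_(i < a) enorm (X i w) ^+ 2 +
  2 * \sum_(j < k) cross_term X a j w.
Proof.
by move=> ak; rewrite -[in \sum_(i < a) _](minn_idPl ak) -sqr_enorm_increment
  /sqdist /increment (minn_idPl ak).
Qed.

(* Distances from the grid points control all distances, since the walk moves
   little between consecutive multiples of h. *)
Lemma sqdist_near_of_grid N h (c r : R) w : (0 < h)%N -> 0 <= c -> 0 <= r ->
  3 * r <= 1 -> h%:R + c * N%:R <= r ^+ 2 * N%:R ->
  (forall a k, (h %| a)%N -> (a <= k <= N)%N ->
     `|sqdist X w a k - (k%:R - a%:R)| <= c * N%:R) ->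
  forall i j, (i <= j <= N)%N -> `|sqdist X w i j - (j%:R - i%:R)| <= 9 * r * N%:R.
Proof.
move=> h0 c0 r0 r1 hr H i j /andP[ij jN].
pose a := (i %/ h * h)%N; have ai : (a <= i)%N by exact: leq_trunc_div.
have ha : (h %| a)%N by exact: dvdn_mull.
have iah : i%:R - a%:R <= h%:R :> R.
  by rewrite -natrB// ler_nat /a {1}(divn_eq i h) addKn ltnW// ltn_pmod.
have cN : 0 <= c * N%:R by rewrite mulr_ge0.
(* The comparison is made on distances, where the triangle inequality applies, and not on their
   squares. [u] bounds each of three errors: moving [i] to the grid point [a], replacing the
   distance from [a] by its target, and moving [a] back to [i] in the target. *)
pose u := r * Num.sqrt N%:R.
have uE : Num.sqrt (r ^+ 2 * N%:R) = u.
  by rewrite sqrtrM ?sqr_ge0// sqrtr_sqr ger0_norm.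
have u0 : 0 <= u by rewrite mulr_ge0// sqrtr_ge0.
pose x := enorm (walk X j w - walk X i w).
have sqd p q : Num.sqrt (sqdist X w p q) = enorm (walk X q w - walk X p w).
  by rewrite sqrtr_sqr ger0_norm// enorm_ge0.
have Dai := H _ i ha; rewrite ai (leq_trans ij jN) in Dai; have {Dai} := Dai isT.
have Daj := H _ j ha; rewrite (leq_trans ai ij) jN in Daj; have {Daj} := Daj isT.
move=> Daj Dai.
have e1 : `|x - enorm (walk X j w - walk X a w)| <= u.
  rewrite /x -!mdist_euclid (metric_sym (walk X j w) (walk X i w)).
  rewrite (metric_sym (walk X j w)) !mdist_euclid.
  apply: (le_trans (ler_enormB _ _ _)); rewrite -sqd -uE ler_wsqrtr//.
  by move: Dai; rewrite ler_norml => /andP[_]; lra.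
have e2 : `|enorm (walk X j w - walk X a w) - Num.sqrt (j%:R - a%:R)| <= u.
  rewrite -sqd; apply: (le_trans (ler_sqrtB _ _)).
  - exact: sqr_ge0.
  - by rewrite subr_ge0 ler_nat (leq_trans ai).
  rewrite -uE ler_wsqrtr// (le_trans Daj)// (le_trans _ hr)// lerDr//.
have e3 : `|Num.sqrt (j%:R - a%:R) - Num.sqrt (j%:R - i%:R)| <= u.
  apply: (le_trans (ler_sqrtB _ _)); rewrite ?subr_ge0 ?ler_nat// ?(leq_trans ai)//.
  rewrite -uE ler_wsqrtr// (_ : _ - _ - _ = i%:R - a%:R); last by ring.
  by rewrite ger0_norm ?subr_ge0 ?ler_nat//; lra.
set y := Num.sqrt (j%:R - i%:R) in e3.
have y0 : 0 <= y by exact: sqrtr_ge0.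
have x0 : 0 <= x by exact: enorm_ge0.
have yN : y <= Num.sqrt N%:R.
  by rewrite ler_wsqrtr// (@le_trans _ _ j%:R)// ?ler_nat// lerBlDr lerDl.
have xy : `|x - y| <= 3 * u.
  move: e1 e2 e3; rewrite !ler_norml => /andP[? ?] /andP[? ?] /andP[? ?].
  by apply/andP; split; lra.
(* Back to squares: [x - y] is at most [3 * u], and [x + y] at most [2 y + 3 u], hence at most three
   times the root of [N]. Together they give the factor 9. *)
have -> : sqdist X w i j - (j%:R - i%:R) = (x - y) * (x + y).
  by rewrite -subr_sqr [y ^+ 2]sqr_sqrtr// subr_ge0 ler_nat.
have u3 : 3 * u <= Num.sqrt N%:R by rewrite mulrA ler_piMl// sqrtr_ge0.
rewrite normrM (_ : 9 * r * N%:R = (3 * u) * (3 * Num.sqrt N%:R)); last first.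
  by rewrite -[N%:R in LHS]sqr_sqrtr// /u; ring.
rewrite ler_pM// ger0_norm ?addr_ge0//.
by move: xy; rewrite ler_norml => /andP[_]; lra.
Qed.

Lemma gh_le_of_grid N h (c r : R) w : (0 < N)%N -> (0 < h)%N -> 0 <= c -> 0 < r ->
  3 * r <= 1 -> h%:R + c * N%:R <= r ^+ 2 * N%:R ->
  (forall a k, (h %| a)%N -> (a <= k <= N)%N ->
     `|sqdist X w a k - (k%:R - a%:R)| <= c * N%:R) ->
  (gromov_hausdorff_dist (bridge_space X N w) (limit_space R) <=
   (Num.sqrt (54 * r) + Num.sqrt N%:R^-1)%:E)%E.
Proof.
move=> N0 h0 c0 r0 r1 hr H; apply: bridge_gh_le => //; first by rewrite sqrtr_gt0 mulr_gt0.
have near := sqdist_near_of_grid h0 c0 (ltW r0) r1 hr H.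
move=> i j ijN; have N0' : 0 < N%:R :> R by rewrite ltr0n.
have bE : bridge_dist X N i j w =
    Num.sqrt (enorm (bridge X N j w - bridge X N i w) ^+ 2 / N%:R).
  by rewrite sqrtrM ?sqr_ge0// sqrtr_sqr ger0_norm ?enorm_ge0// sqrtrV// ltW.
rewrite bE; apply: (le_trans (ler_sqrtB _ _)).
- by rewrite divr_ge0 ?ler0n// sqr_ge0.
- have /andP[ij jN] := ijN; rewrite -mulrBl ger0_norm; last first.
    by rewrite divr_ge0 ?ler0n// subr_ge0 ler_nat.
  rewrite mulr_ge0//; last by rewrite divr_ge0 ?ler0n// subr_ge0 ler_nat.
  by rewrite subr_ge0 ler_pdivrMr// mul1r lerBlDr ler_wpDr// ler_nat.
(* The factor 9 from the grid and the factor 6 from the bridge make 54. *)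
rewrite ler_wsqrtr//; apply: (le_trans (sqr_bridge_dist_near N0 near ijN)).
by lra.
Qed.

End walk_distances.

(** * A probability bound in a fixed dimension *)

Lemma union_bound (R : realType) (dO : measure_display) (Omega : measurableType dO)
    (P : probability Omega R) (B : nat -> set Omega) (b : R) m :
  (forall l, measurable (B l)) -> (forall l, (P (B l) <= b%:E)%E) ->
  (P (\bigcup_(l in `I_m) B l) <= (m%:R * b)%:E)%E.
Proof.
move=> mB PB; elim: m => [|m IH]; first by rewrite II0 bigcup_set0 measure0 mul0r.
rewrite IIS bigcup_setU bigcup_set1.
apply: (le_trans (measureU2 _ (bigcup_measurable _) (mB m))) => //.
by rewrite -[m.+1%:R]natr1 mulrDl mul1r EFinD; apply: leeD => //; exact: PB.
Qed.

(** All the probability is gathered in one non-asymptotic estimate. Its three terms come from the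
    truncated norms, their tails, and the cross terms at [m] grid points; only the choice of
    parameters remains afterwards. *)
Lemma bridge_gh_bound (R : realType) (d : nat) (dO : measure_display)
    (Omega : measurableType dO) (P : probability Omega R)
    (X : nat -> {RV P >-> euclid R d}) (s A z c r e : R) (N m : nat) :
  iid X -> (forall k, \int[P]_w X 0%N w 0 k = 0) ->
  integrable_rv P (fun w => enorm (X 0%N w) ^+ 2) ->
  \int[P]_w enorm (X 0%N w) ^+ 2 = 1 ->
  (forall j k, j != k -> \int[P]_w (X 0%N w 0 j * X 0%N w 0 k) = 0) ->
  (forall k, \int[P]_w (X 0%N w 0 k ^+ 2) <= s) ->
  \int[P]_w tail_sqnorm A (X 0%N w) <= z ->
  0 <= s -> 0 <= A -> 0 < c -> z <= c -> 0 < r -> 3 * r <= 1 ->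
  (0 < N)%N -> (0 < m)%N -> (N %/ m).+1%:R + 8 * c * N%:R <= r ^+ 2 * N%:R ->
  Num.sqrt (54 * r) + Num.sqrt N%:R^-1 <= e -> 0 < e ->
  (P [set w | (e%:E < gromov_hausdorff_dist (bridge_space X N w) (limit_space R))%E] <=
   (A ^+ 2 / (c ^+ 2 * N%:R) + z / c + m%:R * (s / c ^+ 2))%:E)%E.
Proof.
move=> X_iid X_c X_i X_n X_u X_s X_t s0 A0 c0 zc r0 r1 N0 m0 hr re e0.
have N0' : 0 < N%:R :> R by rewrite ltr0n.
(* With this mesh [m * h] exceeds [N], so the multiples [l * h] with [l < m] contain every grid
   point up to [N]. *)
pose h := (N %/ m).+1.
have [B [mB PB HB]] := sum_norms_bad X_iid X_i X_n A0 X_t N0 c0 zc.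
have /choice[C HC] := fun l => cross_term_bad X_iid X_c X_i X_n X_u X_s (l * h)%N N0 s0 c0.
pose D := \bigcup_(l in `I_m) C l.
have mD : measurable D by apply: bigcup_measurable => l _; case: (HC l).
have PD : (P D <= (m%:R * (s / c ^+ 2))%:E)%E.
  by apply: union_bound => l; case: (HC l).
apply: (@le_trans _ _ (P (B `|` D))); last first.
  by rewrite (le_trans (measureU2 _ mB mD))// EFinD leeD.
apply: le_measure; rewrite ?inE.
- apply: measurable_gh_gt => // i k.
  exact: (measurableT_comp (@measurable_coord R d k) (measurable_funP (X i))).
- exact: measurableU.
move=> w /= we; apply: contrapT => /not_orP[nB nD]; move: we; apply/negP.
rewrite -leNgt; apply: (@le_trans _ _ (Num.sqrt (54 * r) + Num.sqrt N%:R^-1)%:E); last first.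
  by rewrite lee_fin.
apply: (@gh_le_of_grid _ _ _ _ _ X N h (8 * c)) => //; first by rewrite mulr_ge0// ltW.
move=> a k /dvdnP[l ->] /andP[lk kN]; rewrite sqdistE//.
have lm : (l < m)%N.
  rewrite -(ltn_pmul2r (isT : (0 < h)%N)) (leq_ltn_trans (leq_trans lk kN))//.
  by rewrite /h mulnC ltn_ceil.
(* The constant 8 is 3 + 3 for the sums of squared norms at [k] and at the grid point, plus 2 for
   the doubled cross terms. *)
have := HB w nB _ kN; have := HB w nB _ (leq_trans lk kN).
have nC : ~ C l w by move=> Cw; apply: nD; exists l.
have [_ _ /(_ w nC k kN)] := HC l.
rewrite !ler_norml => /andP[? ?] /andP[? ?] /andP[? ?].
by apply/andP; split; lra.
Qed.

(** * From extended-valued expectations to real integrals *)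

Section expectation_conversions.
Context (R : realType) (dO : measure_display) (Omega : measurableType dO).
Context (P : probability Omega R).

Lemma Rintegral_of_expectation (f : Omega -> R) (r : R) :
  ('E_P[f] = r%:E)%E -> \int[P]_w f w = r.
Proof. by rewrite unlock /Rintegral => ->. Qed.

Lemma Rintegral_le_of_expectation (f : Omega -> R) (r : R) :
  (forall w, 0 <= f w) -> ('E_P[f] <= r%:E)%E -> \int[P]_w f w <= r.
Proof.
rewrite unlock /Rintegral => f0 fr.
have i0 : (0 <= \int[P]_w (f w)%:E)%E by apply: integral_ge0 => w _; rewrite lee_fin.
rewrite -lee_fin fineK// ge0_fin_numE//; exact: le_lt_trans fr (ltry _).
Qed.

(** For a nonnegative variable a finite expectation is integrability itself; the normalization
    thereby yields the square-integrability of the steps. *)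
Lemma integrable_of_expectation (f : Omega -> R) (r : R) :
  measurable_fun setT f -> (forall w, 0 <= f w) -> ('E_P[f] = r%:E)%E ->
  integrable_rv P f.
Proof.
rewrite unlock => mf f0 fr; apply/integrableP; split; first exact/measurable_EFinP.
under eq_integral => w _ do rewrite /= ger0_norm//.
by rewrite fr ltry.
Qed.

End expectation_conversions.

Lemma sqrtr_le_sqr (R : rcfType) (x y : R) : 0 <= y -> x <= y ^+ 2 -> Num.sqrt x <= y.
Proof. by move=> y0 /ler_wsqrtr; rewrite sqrtr_sqr ger0_norm. Qed.


Theorem theorem2p1 (R : realType) (disp : nat -> measure_display)
  (Omega : forall d : nat, measurableType (disp d))
  (P : forall d : nat, probability (Omega d) R)
  (X : forall d : nat, nat -> {RV (P d) >-> euclid R d})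
  (X_iid : forall d : nat, (0 < d)%N -> iid (X d))
  (X_centered : forall d : nat, (0 < d)%N -> forall k : 'I_d,
     ('E_(P d)[(fun w => X d 0%N w 0 k)%R] = 0)%E)
  (X_normalized : forall d : nat, (0 < d)%N ->
     ('E_(P d)[(fun w => enorm (X d 0%N w) ^+ 2)%R] = 1)%E)
  (X_uncorrelated : forall d : nat, (0 < d)%N -> forall j k : 'I_d, j != k ->
     ('E_(P d)[(fun w => X d 0%N w 0 j * X d 0%N w 0 k)%R] = 0)%E)
  (X_unif_integrable :
     ereal_sup [set ('E_(P d)[(fun w => enorm (X d 0%N w) ^+ 2 *
                   \1_[set w' | A < enorm (X d 0%N w') ^+ 2] w)%R])%E
               | d in [set d : nat | (0 < d)%N]]
       @[A --> +oo%R] --> 0%E)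
  (X_asymp_negligible :
     \big[maxe/-oo%E]_(k < d) ('E_(P d)[(fun w => X d 0%N w 0 k ^+ 2)%R])%E
       @[d --> \oo] --> 0%E)
  (n : nat -> nat)
  (n_gt0 : forall d : nat, (0 < d)%N -> (0 < n d)%N)
  (n_infty : n d @[d --> \oo] --> \oo) :
  cvg_gh_in_probability P (fun d => bridge_space (X d) (n d)) (limit_space R).
Proof.
move=> eps eps0.
suff H (e : R) : 0 < e -> \forall d \near \oo,
    (P d [set w | (eps%:E < gromov_hausdorff_dist (bridge_space (X d) (n d) w)
      (limit_space R))%E] <= e%:E)%E.
  apply/fine_cvgP; split.
    near=> d; rewrite ge0_fin_numE ?measure_ge0//.
    by apply: (@le_lt_trans _ _ 1%:E); [near: d; exact: H|exact: ltry].
  apply/cvgrPdist_le => /= e e0; near=> d.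
  rewrite sub0r normrN ger0_norm ?fine_ge0 ?measure_ge0// -lee_fin fineK.
    by near: d; exact: H.
  rewrite ge0_fin_numE ?measure_ge0//.
  by apply: (@le_lt_trans _ _ 1%:E); [near: d; exact: H|exact: ltry].
move=> e0.
(* The first bound gives [3 * r <= 1]; the second, with 216 = 4 * 54, makes the root of [54 * r] at
   most [eps / 2]. *)
pose r := Num.min 3^-1 (eps ^+ 2 / 216).
have r0 : 0 < r.
  by rewrite lt_min; apply/andP; split; rewrite ?divr_gt0 ?invr_gt0 ?exprn_gt0 ?ltr0n.
have r3 : 3 * r <= 1 by rewrite mulrC -ler_pdivlMr// mul1r ge_min lexx.
have r216 : 216 * r <= eps ^+ 2 by rewrite mulrC -ler_pdivlMr// ge_min lexx orbT.
have r20 : 0 < r ^+ 2 by rewrite exprn_gt0.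
(* Budget for the mesh condition: [8 * c] uses half of [r ^+ 2], and the choice of [m] leaves a
   quarter for [N %/ m] and a quarter for the added 1, once [N] is large. *)
pose c := r ^+ 2 / 16.
have c0 : 0 < c by rewrite divr_gt0.
pose m := (Num.truncn (4 / r ^+ 2)).+1.
have m4 : 4 / r ^+ 2 <= m%:R.
  by have /truncn_itv/andP[_ /ltW] : 0 <= 4 / r ^+ 2 by rewrite divr_ge0// ltW.
have m0 : 0 < m%:R :> R by rewrite ltr0n.
(* [z] and [s] are tuned so that the tail term and the cross terms of [bridge_gh_bound] each
   contribute at most [e / 3]. *)
pose z := Num.min c (c * e / 3).
have z0 : 0 < z by rewrite lt_min c0 divr_gt0 ?mulr_gt0.
have zc : z <= c by rewrite ge_min lexx.
have zce : z / c <= e / 3.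
  by rewrite ler_pdivrMr// (_ : e / 3 * c = c * e / 3) ?ge_min ?lexx ?orbT//; ring.
pose s := e * c ^+ 2 / (3 * m%:R).
have s0 : 0 < s by rewrite divr_gt0 ?mulr_gt0 ?exprn_gt0.
(* A single level [A] must serve every dimension, because the threshold [K] on [n d] depends on it.
   This is where uniform integrability enters. *)
have [A A0 HA] : exists2 A : R, 0 <= A & forall d, (0 < d)%N ->
    ('E_(P d)[(fun w => enorm (X d 0%N w) ^+ 2 *
       \1_[set w' | A < enorm (X d 0%N w') ^+ 2] w)%R] <= z%:E)%E.
  have /fine_cvgP[Ffin /cvgrPdist_le /(_ z z0) Fz] := X_unif_integrable.
  near (pinfty_nbhs R) => A; exists A; first by near: A; exact: nbhs_pinfty_ge.
  move=> d d0; have fA : (ereal_sup [set ('E_(P d)[(fun w => enorm (X d 0%N w) ^+ 2 *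
      \1_[set w' | A < enorm (X d 0%N w') ^+ 2] w)%R])%E
      | d in [set d : nat | (0 < d)%N]] \is a fin_num)%E by near: A.
  apply: (@le_trans _ _ (ereal_sup [set ('E_(P d)[(fun w => enorm (X d 0%N w) ^+ 2 *
      \1_[set w' | A < enorm (X d 0%N w') ^+ 2] w)%R])%E
      | d in [set d : nat | (0 < d)%N]])); first by apply: ereal_sup_ubound; exists d.
  rewrite -(fineK fA) lee_fin (le_trans (ler_norm _))// -normrN -sub0r.
  by near: A.
have c20 : 0 < c ^+ 2 by rewrite exprn_gt0.
(* The summands ensure, in order, that the added 1 fits the mesh budget, that the root of [1 / n] is
   at most [eps / 2], and that the truncation term is at most [e / 3]. *)
pose K := (Num.truncn (4 / r ^+ 2 + 4 / eps ^+ 2 + 3 * A ^+ 2 / (c ^+ 2 * e))).+1.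
have nK : \forall d \near \oo, (K <= n d)%N.
  have : nbhs \oo [set k | (K <= k)%N] by exists K.
  by move=> /n_infty.
have small : \forall d \near \oo, forall k : 'I_d,
    ('E_(P d)[(fun w => X d 0%N w 0 k ^+ 2)%R] <= s%:E)%E.
  have /fine_cvgP[Ffin /cvgrPdist_le /(_ s s0) Fs] := X_asymp_negligible.
  near=> d => k; have fd : (\big[maxe/-oo%E]_(k < d)
    ('E_(P d)[(fun w => X d 0%N w 0 k ^+ 2)%R])%E \is a fin_num)%E by near: d.
  apply: (@le_trans _ _ (\big[maxe/-oo%E]_(k < d)
    ('E_(P d)[(fun w => X d 0%N w 0 k ^+ 2)%R])%E)); first exact: le_bigmax.
  rewrite -(fineK fd) lee_fin (le_trans (ler_norm _))// -normrN -sub0r.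
  by near: d.
near=> d.
have d0 : (0 < d)%N by near: d; exact: nbhs_infty_gt.
have Kn : (K <= n d)%N by near: d.
have n0 := n_gt0 d d0; have n0' : 0 < (n d)%:R :> R by rewrite ltr0n.
have [t1 t2 t3] : [/\ 0 <= 4 / r ^+ 2, 0 <= 4 / eps ^+ 2 &
    0 <= 3 * A ^+ 2 / (c ^+ 2 * e)].
  by split; rewrite divr_ge0 ?mulr_ge0 ?sqr_ge0// ltW.
have KnR : 4 / r ^+ 2 + 4 / eps ^+ 2 + 3 * A ^+ 2 / (c ^+ 2 * e) <= (n d)%:R.
  have /truncn_itv/andP[_ /ltW /le_trans] :
    0 <= 4 / r ^+ 2 + 4 / eps ^+ 2 + 3 * A ^+ 2 / (c ^+ 2 * e) by rewrite !addr_ge0.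
  by apply; rewrite ler_nat.
have N1 : 4 <= r ^+ 2 * (n d)%:R by rewrite mulrC -ler_pdivrMr//; lra.
have N2 : 4 <= eps ^+ 2 * (n d)%:R by rewrite mulrC -ler_pdivrMr ?exprn_gt0//; lra.
have N3 : 3 * A ^+ 2 <= c ^+ 2 * e * (n d)%:R.
  by rewrite [leRHS]mulrC -ler_pdivrMr ?mulr_gt0//; lra.
have mX2 : measurable_fun setT (fun w => enorm (X d 0%N w) ^+ 2).
  apply: measurable_funX; apply: measurable_enorm => k.
  exact: (measurableT_comp (@measurable_coord R d k) (measurable_funP (X d 0%N))).
apply: (le_trans (@bridge_gh_bound R d _ _ (P d) (X d) s A z c r eps (n d) m
  (X_iid d d0) _ _ _ _ _ _ (ltW s0) A0 c0 zc r0 r3 n0 isT _ _ eps0)).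
- by move=> k; exact: Rintegral_of_expectation (X_centered d d0 k).
- by apply: integrable_of_expectation (X_normalized d d0) => // w; exact: sqr_ge0.
- exact: Rintegral_of_expectation (X_normalized d d0).
- by move=> j k jk; exact: Rintegral_of_expectation (X_uncorrelated d d0 j k jk).
- move=> k; apply: Rintegral_le_of_expectation => [w|]; first exact: sqr_ge0.
  by move: k; near: d.
- apply: Rintegral_le_of_expectation => [w|].
    by rewrite /tail_sqnorm; case: ifP; rewrite ?sqr_ge0.
  apply: le_trans (HA _ d0); rewrite le_eqVlt; apply/orP; left; apply/eqP.
  congr expectation; apply/funext => w; rewrite indicE /tail_sqnorm.
  case: ifP => [H|/negbT H]; first by rewrite mem_set// mulr1.
  by rewrite memNset ?mulr0//; exact/negP.
- have h1 : (n d %/ m)%:R <= r ^+ 2 * (n d)%:R / 4.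
    apply: (@le_trans _ _ ((n d)%:R / m%:R)).
      by rewrite ler_pdivlMr// -natrM ler_nat leq_trunc_div.
    rewrite ler_pdivrMr//; apply: (@le_trans _ _ (r ^+ 2 * (n d)%:R / 4 * (4 / r ^+ 2))).
      by rewrite le_eqVlt; apply/orP; left; apply/eqP; field; rewrite gt_eqF.
    by rewrite ler_wpM2l// divr_ge0// mulr_ge0// ltW.
  by rewrite -natr1 /c; lra.
- have e20 : 0 <= eps / 2 by rewrite divr_ge0 ?ltW.
  have sq1 : Num.sqrt (54 * r) <= eps / 2.
    by apply: sqrtr_le_sqr => //; rewrite expr_div_n; lra.
  have sq2 : Num.sqrt (n d)%:R^-1 <= eps / 2.
    apply: sqrtr_le_sqr => //.
    by rewrite -[leLHS]mul1r ler_pdivrMr// expr_div_n; lra.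
  by rewrite [leRHS]splitr lerD.
rewrite lee_fin.
have b1 : A ^+ 2 / (c ^+ 2 * (n d)%:R) <= e / 3.
  by rewrite ler_pdivrMr ?mulr_gt0//; lra.
have b3 : m%:R * (s / c ^+ 2) = e / 3.
  by rewrite /s; field; rewrite !gt_eqF.
by rewrite b3; lra.
Unshelve. all: by end_near.
Qed.
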